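(* Let $M^{2n}$ be a nilmanifold with associated nilpotent Lie algebra $\mathfrak{g}$, of nilpotency index $\mathrm{nil}(\mathfrak{g})$. Suppose there exists an integer $j>0$ such that $$\dim\left(V_{i+1}/V_i\right)=1\qquad\text{for all } i \text{ with } j\le i<\mathrm{nil}(\mathfrak{g}).$$ Then $M$ cannot admit left-invariant generalized complex structures of type $k$ for $k\geq 2n-\mathrm{nil}(\mathfrak{g})+j$. In particular, if $M$ has maximal nilpotency index (i.e. $\dim V_1=2$ and $\dim V_i/V_{i-1}=1$ for all $1<i\le\mathrm{nil}(\mathfrak{g})$), then it does not admit left-invariant generalized complex structures of type $k$ for $k\geq2$.
   Context: A nilmanifold is a quotient $M=\Gamma\backslash G$ of a connected, simply-connected nilpotent real Lie group $G$ (with Lie algebra $\mathfrak{g}$) by a maximal lattice (discrete cocompact subgroup) $\Gamma$. Let $\mathfrak{g}^0=\mathfrak{g}$, $\mathfrak{g}^k=[\mathfrak{g}^{k-1},\mathfrak{g}]$; the nilpotency index $\mathrm{nil}(\mathfrak{g})$ is the smallest $s$ with $\mathfrak{g}^s=0$. $V_i\subset\mathfrak{g}^*$ is the annihilator of $\mathfrak{g}^i$; equivalently $V_0=\{0\}$ and $V_i=\{v\in\mathfrak{g}^*: dv\in\wedge^2V_{i-1}\}$, where $d$ is the Chevalley–Eilenberg differential. A generalized complex structure on $M^{2n}$ is an endomorphism $\mathcal{J}$ of $TM\oplus T^*M$, orthogonal for $\langle X+\xi,Y+\eta\rangle=\frac12(\xi(Y)+\eta(X))$, with $\mathcal{J}^2=-\mathrm{Id}$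 and $+i$-eigenbundle $L$ closed under the Courant bracket $[X+\xi,Y+\eta]=[X,Y]+X\lfloor d\eta-Y\lfloor d\xi+\frac12d(X\lfloor\eta-Y\lfloor\xi)$. Forms annihilated pointwise by $L$ (under $(X+\xi)\cdot\rho=X\lfloor\rho+\xi\wedge\rho$) form a complex line generated by some $e^{B+i\omega}\Omega$, with $B,\omega$ real $2$-forms and $\Omega$ decomposable complex; the degree of $\Omega$ is the type. A structure on $\Gamma\backslash G$ is called left-invariant if it descends from a left-invariant structure on $G$; it has constant type. *)

(* Defs.v *)
From HB Require Import structures.
From mathcomp Require Import all_boot all_order all_algebra.
From mathcomp Require Import complex.
From mathcomp Require Import all_classical all_reals all_analysis.

Set Implicit Arguments.
Unset Strict Implicit.
Unset Printing Implicit Defensive.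

Import Order.TTheory GRing.Theory Num.Theory.
Import numFieldTopology.Exports numFieldNormedType.Exports.

Local Open Scope classical_set_scope.
Local Open Scope ring_scope.

(** * Smooth functions on open subsets of normed spaces *)

Section Smooth.
Context {R : realType}.

(* Only used with [U] open and [V] finite-dimensional; the continuity of all
   the directional derivatives [x |-> 'd f x v] is then that of ['d f]. *)
Fixpoint Ck_on (V W : normedModType R) (k : nat) (U : set V) (f : V -> W)
    : Prop :=
  match k with
  | 0 => forall x, U x -> {for x, continuous f}
  | k'.+1 => (forall x, U x -> differentiable f x) /\
             (forall v, Ck_on k' U (fun x => 'd f x v))
  end.

Definition smooth_on (V W : normedModType R) (U : set V) (f : V -> W) : Prop :=
  forall k, Ck_on k U f.

End Smooth.

(** * Smooth manifolds *)

Section Manifolds.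
Context {R : realType} {m : nat}.
Local Notation E := 'rV[R]_m.

(* A chart is a homeomorphism between open sets [dom c] and [cod c]; [cmap] and
   [cinv] are total functions whose values outside these sets are irrelevant. *)
Record chart (T : Type) := Chart {
  dom : set T;
  cmap : T -> E;
  cinv : E -> T }.

Definition cod (T : Type) (c : chart T) : set E := cmap c @` dom c.

Record chart_ok (T : topologicalType) (c : chart T) : Prop := ChartOk {
  open_dom : open (dom c);
  open_cod : open (cod c);
  cmapK : forall x, dom c x -> cinv c (cmap c x) = x;
  continuous_cmap : forall x, dom c x -> {for x, continuous (cmap c)};
  continuous_cinv : forall p, cod c p -> {for p, continuous (cinv c)} }.

(* Atlases are not required to be maximal. *)
Record manifold := Manifold {
  msort :> topologicalType;
  atlas : set (chart msort);
  manifold_hausdorff : hausdorff_space msort;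
  manifold_second_countable : @second_countable msort;
  atlas_ok : forall c, atlas c -> chart_ok c;
  atlas_cover : forall x : msort, exists2 c, atlas c & dom c x;
  atlas_transition : forall c c', atlas c -> atlas c' ->
    smooth_on (cmap c @` (dom c `&` dom c')) (cmap c' \o cinv c) }.

Definition smooth_map_on (M N : manifold) (U : set M) (f : M -> N) : Prop :=
  (forall x, U x -> {for x, continuous f}) /\
  (forall c c', atlas c -> atlas c' ->
    smooth_on (cmap c @` (U `&` dom c `&` f @^-1` dom c'))
              (cmap c' \o f \o cinv c)).

Definition smooth_map (M N : manifold) (f : M -> N) : Prop :=
  smooth_map_on setT f.

Definition local_diffeo (M N : manifold) (f : M -> N) : Prop :=
  forall x, exists (U : set M) (V : set N) (g : N -> M),
    [/\ [/\ open U, U x & open V],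
        forall y, U y -> V (f y) /\ g (f y) = y,
        forall z, V z -> U (g z) /\ f (g z) = z,
        smooth_map_on U f & smooth_map_on V g].

End Manifolds.

Arguments chart R m T : clear implicits.
Arguments manifold R m : clear implicits.

(** * The generalized tangent bundle in coordinates

   The fibre of TM (+) T*M in a chart is the space of row vectors
   [row_mx X xi] of length m + m, where the one-form [xi] is given by its
   components in the dual basis. Endomorphisms act by right multiplication. *)

Section GeneralizedTangent.
Context {R : realType} {m : nat}.
Local Notation E := 'rV[R]_m.
Local Notation GE := 'rV[R]_(m + m).

Definition eval (F : fieldType) (xi X : 'rV[F]_m) : F :=
  \sum_(i < m) xi 0 i * X 0 i.

Definition gpair (F : fieldType) (u v : 'rV[F]_(m + m)) : F :=
  2^-1 * (eval (rsubmx u) (lsubmx v) + eval (rsubmx v) (lsubmx u)).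

Definition lie (X Y : E -> E) (p : E) : E := 'd Y p (X p) - 'd X p (Y p).

(* The one-form X _| d xi, by the formula
   (d xi)_p(u, v) = (D_u xi)(v) - (D_v xi)(u). *)
Definition contract_d (X xi : E -> E) (p : E) : E :=
  \row_j (eval ('d xi p (X p)) (delta_mx 0 j)
          - eval ('d xi p (delta_mx 0 j)) (X p)).

Definition grad (h : E -> R^o) (p : E) : E := \row_j 'd h p (delta_mx 0 j).

Definition courant (s t : E -> GE) (p : E) : GE :=
  let X q := lsubmx (s q) in let xi q := rsubmx (s q) in
  let Y q := lsubmx (t q) in let eta q := rsubmx (t q) in
  row_mx (lie X Y p)
    (contract_d X eta p - contract_d Y xi p
     + 2^-1 *: grad (fun q => eval (eta q) (X q) - eval (xi q) (Y q)) p).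

Definition re_mx (a b : nat) (A : 'M[R[i]]_(a, b)) : 'M[R]_(a, b) :=
  map_mx (@complex.Re R) A.
Definition im_mx (a b : nat) (A : 'M[R[i]]_(a, b)) : 'M[R]_(a, b) :=
  map_mx (@complex.Im R) A.
Definition cplx_mx (a b : nat) (A B : 'M[R]_(a, b)) : 'M[R[i]]_(a, b) :=
  \matrix_(k, l) Complex (A k l) (B k l).

(* Complex-bilinear extension of the Courant bracket. *)
Definition courantC (s t : E -> 'rV[R[i]]_(m + m)) (p : E) :
    'rV[R[i]]_(m + m) :=
  let s1 q := re_mx (s q) in let s2 q := im_mx (s q) in
  let t1 q := re_mx (t q) in let t2 q := im_mx (t q) in
  cplx_mx (courant s1 t1 p - courant s2 t2 p)
          (courant s1 t2 p + courant s2 t1 p).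

Definition smoothC_on (U : set E) (s : E -> 'rV[R[i]]_(m + m)) : Prop :=
  smooth_on U (fun q => re_mx (s q)) /\ smooth_on U (fun q => im_mx (s q)).

(* The rows of [eigL J] span the +i-eigenspace of [J]. *)
Definition eigL (J : 'M[R]_(m + m)) : 'M[R[i]]_(m + m) :=
  eigenspace (cplx_mx J 0) (Complex 0 1).

(* Differential at [x] of [f], and the map induced on TM (+) T*M when it is
   invertible: one-forms are transported by the inverse of the pullback. *)
Definition jac (M N : manifold R m) (f : M -> N) (c : chart R m M)
    (c' : chart R m N) (x : M) : 'M[R]_m :=
  jacobian (cmap c' \o f \o cinv c) (cmap c x).

Definition gjac (M N : manifold R m) (f : M -> N) (c : chart R m M)
    (c' : chart R m N) (x : M) : 'M[R]_(m + m) :=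
  let A := jac f c c' x in block_mx A 0 0 (invmx A)^T.

(* A field of endomorphisms of TM (+) T*M, given by its matrix in every chart. *)
Definition endo_field (M : manifold R m) := chart R m M -> E -> 'M[R]_(m + m).

(* [f] is meant to be a local diffeomorphism. [intertwines id J J] is the
   compatibility of the coordinate expressions of [J]. *)
Definition intertwines (M N : manifold R m) (f : M -> N)
    (J : endo_field M) (J' : endo_field N) : Prop :=
  forall c c' x, atlas c -> atlas c' -> dom c x -> dom c' (f x) ->
    J c (cmap c x) *m gjac f c c' x = gjac f c c' x *m J' c' (cmap c' (f x)).

Definition courant_involutive (M : manifold R m) (J : endo_field M) : Prop :=
  forall (c : chart R m M) (U : set E) (s t : E -> 'rV[R[i]]_(m + m)),
    atlas c -> open U -> U `<=` cod c -> smoothC_on U s -> smoothC_on U t ->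
    (forall p, U p -> (s p <= eigL (J c p))%MS) ->
    (forall p, U p -> (t p <= eigL (J c p))%MS) ->
    forall p, U p -> (courantC s t p <= eigL (J c p))%MS.

Record generalized_complex (M : manifold R m) (J : endo_field M) : Prop :=
  GeneralizedComplex {
    gc_intertwines : intertwines id J J;
    gc_smooth : forall c, atlas c -> smooth_on (cod c) (J c);
    gc_orthogonal : forall c p, atlas c -> cod c p ->
      forall u v : GE, gpair (u *m J c p) (v *m J c p) = gpair u v;
    gc_square : forall c p, atlas c -> cod c p -> J c p *m J c p = - 1%:M;
    gc_integrable : courant_involutive J }.

End GeneralizedTangent.

(** * Differential forms at a point and the type

   [alpha : form m F] has component [alpha S] on e_{i1} /\ ... /\ e_{ik},
   where S = {i1 < ... < ik} and (e_i) is the dual of the coordinate basis. *)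

Section Forms.
Context {m : nat} {F : fieldType}.
Definition form := {ffun {set 'I_m} -> F^o}.

Definition shuffle_sign (A B : {set 'I_m}) : F :=
  (-1) ^+ #|[set ab : 'I_m * 'I_m |
              [&& ab.1 \in A, ab.2 \in B & (ab.2 < ab.1)%N]]%SET|.

Definition wedge (alpha beta : form) : form :=
  [ffun S : {set 'I_m} => \sum_(A : {set 'I_m} | A \subset S)
     shuffle_sign A (S :\: A)%SET * alpha A * beta (S :\: A)%SET].

Definition form1 : form := [ffun S : {set 'I_m} => (S == finset.set0)%:R].

Definition covector (xi : 'rV[F]_m) : form :=
  [ffun S : {set 'I_m} => \sum_(i < m | S == [set i]%SET) xi 0 i].

Definition contract (X : 'rV[F]_m) (alpha : form) : form :=
  [ffun S : {set 'I_m} => \sum_(i < m | i \notin S)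
     shuffle_sign [set i]%SET S * X 0 i * alpha (i |: S)%SET].

Definition clifford (u : 'rV[F]_(m + m)) (alpha : form) : form :=
  contract (lsubmx u) alpha + wedge (covector (rsubmx u)) alpha.

(* The exponential series stops at the top degree when beta has no component
   of degree 0. *)
Definition exp_form (beta : form) : form :=
  \sum_(p < m.+1) (p`!%:R)^-1 *: iter p (wedge beta) form1.

Definition wedge_all (k : nat) (theta : 'I_k -> 'rV[F]_m) : form :=
  \big[wedge/form1]_(l < k) covector (theta l).

End Forms.

Arguments form m F : clear implicits.

Section TypeOfStructure.
Context {R : realType} {m : nat}.

Definition two_form (B : form m R) : Prop :=
  forall S : {set 'I_m}, #|S| != 2 -> B S = 0.

Definition complex_form (B w : form m R) : form m R[i] :=
  [ffun S : {set 'I_m} => Complex (B S) (w S)].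

(* The forms annihilated by [L] are the complex line generated by
   e^{B + i w} theta_1 /\ ... /\ theta_k. *)
Definition subspace_has_type (L : 'M[R[i]]_(m + m)) (k : nat) : Prop :=
  exists (B w : form m R) (theta : 'I_k -> 'rV[R[i]]_m),
    [/\ two_form B, two_form w &
      let rho := wedge (exp_form (complex_form B w)) (wedge_all theta) in
      rho != 0 /\
      forall phi : form m R[i],
        (forall u : 'rV[R[i]]_(m + m), (u <= L)%MS -> clifford u phi = 0) <->
        (exists a : R[i], phi = a *: rho)].

Definition has_type (M : manifold R m) (J : endo_field M) (k : nat) : Prop :=
  forall c p, atlas c -> cod c p -> subspace_has_type (eigL (J c p)) k.

End TypeOfStructure.

(** * Nilpotent Lie groups and nilmanifolds *)

Section LieGroups.
Context {R : realType} {m : nat}.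
Local Notation E := 'rV[R]_m.

Record lieGroup := LieGroup {
  gman :> manifold R m;
  gone : gman;
  gmul : gman -> gman -> gman;
  ginv : gman -> gman;
  gmulA : forall x y z, gmul x (gmul y z) = gmul (gmul x y) z;
  gmul1 : forall x, gmul gone x = x;
  gmulV : forall x, gmul (ginv x) x = gone;
  gmul_continuous : continuous (fun xy : gman * gman => gmul xy.1 xy.2);
  gmul_smooth : forall a b c, atlas a -> atlas b -> atlas c ->
    smooth_on
      ((fun xy => (cmap a xy.1, cmap b xy.2)) @`
         [set xy | [/\ dom a xy.1, dom b xy.2 & dom c (gmul xy.1 xy.2)]])
      (fun pq : E * E => cmap c (gmul (cinv a pq.1) (cinv b pq.2)));
  ginv_smooth : smooth_map ginv }.

Definition simply_connected (T : topologicalType) : Prop :=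
  connected [set: T] /\
  forall f : R -> T, {within `[0, 1], continuous f} -> f 0 = f 1 ->
    exists H : R * R -> T,
      [/\ {within `[0, 1] `*` `[0, 1], continuous H},
          forall t, t \in `[0, 1] -> H (t, 0) = f t,
          forall t, t \in `[0, 1] -> H (t, 1) = f 0 &
          forall u, u \in `[0, 1] -> H (0, u) = f 0 /\ H (1, u) = f 0].

(* From here on [c] is a chart around the identity; it identifies the Lie
   algebra g = T_1 G with 'rV_m, and g^* with 'rV_m through [eval]. *)

Definition left_invariant_field (G : lieGroup) (c : chart R m G) (v : E) :
    E -> E :=
  fun p => 'd (cmap c \o gmul (cinv c p) \o cinv c) (cmap c (gone G)) v.

Definition lie_bracket (G : lieGroup) (c : chart R m G) (u v : E) : E :=
  lie (left_invariant_field c u) (left_invariant_field c v) (cmap c (gone G)).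

(* As the bracket is bilinear, bases suffice to span [g^{k-1}, g]. *)
Fixpoint lower_central (G : lieGroup) (c : chart R m G) (k : nat) : {vspace E} :=
  match k with
  | 0 => fullv
  | k'.+1 => <<[seq lie_bracket c u v | u <- vbasis (lower_central c k'),
                                        v <- vbasis (@fullv R E)]>>%VS
  end.

Definition nilpotency_index (G : lieGroup) (c : chart R m G) (s : nat) : Prop :=
  lower_central c s = 0%VS /\
  forall t, (t < s)%N -> lower_central c t <> 0%VS.

Definition nilpotent_group (G : lieGroup) : Prop :=
  forall c : chart R m G, atlas c -> dom c (gone G) ->
  exists s, lower_central c s = 0%VS.

Definition annihilator (W : {vspace E}) : {vspace E} :=
  (\bigcap_(w <- vbasis W) lker (linfun (fun xi : E => eval xi w : R^o)))%VS.

Definition Vspace (G : lieGroup) (c : chart R m G) (i : nat) : {vspace E} :=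
  annihilator (lower_central c i).

Record is_discrete_subgroup (G : lieGroup) (Gamma : set G) : Prop := {
  lattice1 : Gamma (gone G);
  latticeM : forall x y, Gamma x -> Gamma y -> Gamma (gmul x y);
  latticeV : forall x, Gamma x -> Gamma (ginv x);
  lattice_discrete : forall x, Gamma x ->
    exists2 U : set G, open U & U `&` Gamma = [set x] }.

(* [M], with projection [pi], is the quotient manifold [Gamma \ G]; the
   lattice is cocompact as [M] is compact. *)
Record is_nilmanifold (M : manifold R m) (G : lieGroup) (Gamma : set G)
    (pi : G -> M) : Prop := {
  nilm_simply_connected : simply_connected G;
  nilm_nilpotent : nilpotent_group G;
  nilm_discrete : is_discrete_subgroup Gamma;
  nilm_surjective : forall y : M, exists x, pi x = y;
  nilm_fibres : forall x y,
    pi x = pi y <-> exists2 g, Gamma g & y = gmul g x;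
  nilm_local_diffeo : local_diffeo pi;
  nilm_compact : compact [set: M] }.

Definition left_invariant (G : lieGroup) (J : endo_field G) : Prop :=
  forall a : G, intertwines (gmul a) J J.

Definition admits_left_invariant_gcs (M : manifold R m) (G : lieGroup)
    (pi : G -> M) (k : nat) : Prop :=
  exists (J : endo_field M) (JG : endo_field G),
    [/\ generalized_complex J,
        generalized_complex JG /\ left_invariant JG,
        intertwines pi JG J &
        has_type J k].

End LieGroups.

Arguments lieGroup R m : clear implicits.

(* Main.v *)
From HB Require Import structures.
From Pilot Require Import Defs.
From mathcomp Require Import all_boot all_order all_algebra.
From mathcomp Require Import complex zify ring.
From mathcomp Require Import all_classical all_reals all_analysis.

Set Implicit Arguments.
Unset Strict Implicit.
Unset Printing Implicit Defensive.

(** Write g for the Lie algebra of the group and g_C for its complexification.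
    The +i-eigenspace L of a left-invariant generalized complex structure
    projects to a subspace E of g_C, here called its holomorphic part, and the
    theorem only depends on three properties of E.

    - Codimension ([rank_holomorphic_part]): if the type is k then codim E >= k.
      A generator rho of the forms annihilated by L has no component of degree
      less than k, and the vectors of E contract the lowest-degree part of rho
      to zero; a nonzero form of degree d can only be killed by a subspace of
      codimension at least d ([rank_annihilator_spinor]).
    - Transversality ([eigL_conj_full]): E and its conjugate span g_C, since
      this holds for L.
    - Involutivity ([holomorphic_part_subalgebra]): E is a subalgebra, since
      vector parts of Courant brackets are Lie brackets. The sections of L
      to which involutivity is applied are u - i u J with u constant in a
      chart; along such a section the vector part stays in the left-invariant
      distribution spanned by E, hence deviates from a left-invariant field,
      to first order, by a vector of E ([deviation_holomorphic]).

    Let W_i = E + g^i, so that W_0 = g_C and W_i = E once g^i = 0. Then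
    codim W_i is at most half of codim g^i = dim V_i ([codim_W]), and E = g_C
    if W_1 = g_C ([subalgebra_full]). When g^i/g^(i+1) is a line,
    W_i = W_(i-1) forces W_(i+1) = W_i ([stationary_step]): no jump of the
    sequence can follow a stationary step. So, when these quotients are lines
    for all i >= j, the sequence decreases strictly from W_j down to some W_J
    and then equals E. Comparing codim W_J with dim V_J = dim V_j + (J - j)
    gives codim E < dim V_j ([rank_subalgebra_gt]). As
    dim V_j = 2n - nil(g) + j, the type is smaller than this number. The
    second claim is the case j = 1, where dim V_1 = 2. *)

(** * Complex vectors as pairs of real vectors *)

Section Complexification.
Import GRing.Theory Num.Theory.
Local Open Scope ring_scope.
Local Open Scope complex_scope.
Context {R : realType}.
Implicit Types a b d : nat.

Lemma re_cplx a b (A B : 'M[R]_(a, b)) : re_mx (cplx_mx A B) = A.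
Proof. by apply/matrixP => i j; rewrite !mxE. Qed.

Lemma im_cplx a b (A B : 'M[R]_(a, b)) : im_mx (cplx_mx A B) = B.
Proof. by apply/matrixP => i j; rewrite !mxE. Qed.

Lemma cplx_re_im a b (A : 'M[R[i]]_(a, b)) : cplx_mx (re_mx A) (im_mx A) = A.
Proof. by apply/matrixP => i j; rewrite !mxE; case: (A i j). Qed.

Lemma cplx_mxE a b (A B : 'M[R]_(a, b)) :
  cplx_mx A B = map_mx (real_complex R) A + 'i *: map_mx (real_complex R) B.
Proof. by apply/matrixP => i j; rewrite !mxE; simpc. Qed.

Lemma cplx_mx_real a b (A : 'M[R]_(a, b)) :
  cplx_mx A 0 = map_mx (real_complex R) A.
Proof. by rewrite cplx_mxE map_mx0 scaler0 addr0. Qed.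

Lemma cplx_mxD a b (A B A' B' : 'M[R]_(a, b)) :
  cplx_mx A B + cplx_mx A' B' = cplx_mx (A + A') (B + B').
Proof. by apply/matrixP => i j; rewrite !mxE. Qed.

Lemma cplx_mxN a b (A B : 'M[R]_(a, b)) : - cplx_mx A B = cplx_mx (- A) (- B).
Proof. by apply/matrixP => i j; rewrite !mxE. Qed.

Lemma cplx_mxZi a b (A B : 'M[R]_(a, b)) : 'i *: cplx_mx A B = cplx_mx (- B) A.
Proof. by apply/matrixP => i j; rewrite !mxE; simpc. Qed.

Lemma cplx_mulmx a b d (A B : 'M[R]_(a, b)) (A' B' : 'M[R]_(b, d)) :
  cplx_mx A B *m cplx_mx A' B' =
  cplx_mx (A *m A' - B *m B') (A *m B' + B *m A').
Proof.
rewrite !cplx_mxE mulmxDl !mulmxDr -!scalemxAl -!scalemxAr scalerA.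
rewrite -expr2 sqr_i scaleN1r -!map_mxM map_mxB map_mxD scalerDr.
by rewrite [X in _ + _ + X]addrC addrACA.
Qed.

Lemma cplx_mx_eq0 a b (A B : 'M[R]_(a, b)) : cplx_mx A B = 0 -> A = 0 /\ B = 0.
Proof.
move=> /matrixP h; split; apply/matrixP => i j; have := h i j;
by rewrite !mxE => -[].
Qed.

Lemma lsubmx_cplx a b d (A B : 'M[R]_(a, b + d)) :
  lsubmx (cplx_mx A B) = cplx_mx (lsubmx A) (lsubmx B).
Proof. by apply/matrixP => i j; rewrite !mxE. Qed.

End Complexification.

(** * Differential calculus *)

Section Calculus.
Import Order.TTheory GRing.Theory Num.Theory.
Import numFieldTopology.Exports numFieldNormedType.Exports.
Local Open Scope classical_set_scope.
Local Open Scope ring_scope.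
Context {R : realType}.
Implicit Types V W : normedModType R.

Lemma near_eq_is_diff V W (f g : V -> W) x :
  {near x, f =1 g} -> differentiable f x ->
  differentiable g x /\ 'd g x = 'd f x :> (V -> W).
Proof.
move=> fg df.
have dh : is_diff x (g - f) 0.
  have h0 : (g - f) \o shift x =
      cst ((g - f) x) + (\0 : {linear V -> W}) +o_ 0 id.
    apply/eqaddoP => e e0.
    have : \forall y \near 0, f (y + x) = g (y + x).
      move: fg; rewrite (near_shift 0 x) /=.
      by apply: filterS => y; rewrite /= subr0.
    apply: filterS => y /= fgy; rewrite !fctE /= (nbhs_singleton fg) fgy !subrr.
    by rewrite addr0 subr0 normr0 mulr_ge0 // ltW.
  have c0 : continuous (\0 : {linear V -> W}) by exact: cst_continuous.
  have dE := diff_unique c0 h0.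
  apply: DiffDef; last by rewrite dE.
  by apply/diff_locallyP; rewrite dE; split.
have -> : g = f + (g - f) by rewrite addrC subrK.
split; first by apply: differentiableD => //; apply: ex_diff.
by rewrite diffD // [X in _ \+ X]diff_val; apply/funext => v /=; rewrite addr0.
Qed.

Lemma near_eq_continuous (T U : topologicalType) (f g : T -> U) x :
  {near x, f =1 g} -> {for x, continuous f} -> {for x, continuous g}.
Proof.
move=> fg; rewrite /prop_for /continuous_at -(nbhs_singleton fg).
exact: cvg_trans (near_eq_cvg fg).
Qed.

Lemma cvg_mx (T : Type) (F : set_system T) (FF : Filter F) (a b : nat)
    (f : T -> 'M[R]_(a, b)) (A : 'M[R]_(a, b)) :
  (forall i j, f x i j @[x --> F] --> A i j) -> f @ F --> A.
Proof.
move=> fc; apply/cvg_ballP => e e0.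
have : \forall p \near F, forall i j, ball (A i j) e (f p i j).
  apply: filter_forall => i; apply: filter_forall => j.
  by have /cvg_ballP/(_ e e0) := fc i j.
by apply: filterS => p fp; split.
Qed.

Lemma continuous_mx (T : topologicalType) (a b : nat)
    (f : T -> 'M[R]_(a, b)) x :
  (forall i j, {for x, continuous (fun p => f p i j)}) -> {for x, continuous f}.
Proof. by move=> fc; apply: cvg_mx. Qed.

Lemma Ck_on_ext V W k (U : set V) (f g : V -> W) : open U ->
  (forall x, U x -> f x = g x) -> Ck_on k U f -> Ck_on k U g.
Proof.
move=> Uo; elim: k f g => [|k IH] f g fg /= Cf.
  move=> x Ux; apply: near_eq_continuous (Cf x Ux).
  by apply: filterS (open_nbhs_nbhs (conj Uo Ux)).
have fgx x : U x -> {near x, f =1 g}.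
  by move=> Ux; apply: filterS (open_nbhs_nbhs (conj Uo Ux)).
split=> [x Ux|v]; first by have [] := near_eq_is_diff (fgx x Ux) (Cf.1 x Ux).
apply: IH (Cf.2 v) => x Ux.
by have [_ ->] := near_eq_is_diff (fgx x Ux) (Cf.1 x Ux).
Qed.

Lemma Ck_on_linear V W W' k (U : set V) (f : V -> W) (l : {linear W -> W'}) :
  open U -> continuous l -> Ck_on k U f -> Ck_on k U (l \o f).
Proof.
move=> Uo lc; elim: k f => [|k IH] f /= Cf.
  by move=> x Ux; apply: continuous_comp (Cf x Ux) (lc _).
split=> [x Ux|v].
  by apply: differentiable_comp (Cf.1 x Ux) _; apply: linear_differentiable.
apply: Ck_on_ext (IH _ (Cf.2 v)) => // x Ux.
rewrite diff_comp ?diff_lin //=; first exact: Cf.1.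
exact: linear_differentiable.
Qed.

Lemma smooth_on_affine V W W' (U : set V) (f : V -> W)
    (l : {linear W -> W'}) a :
  open U -> continuous l -> smooth_on U f -> smooth_on U (fun x => a + l (f x)).
Proof.
move=> Uo lc sf [|k].
  move=> x Ux; apply: cvgD; first exact: cvg_cst.
  by apply: continuous_comp (sf 0 x Ux) (lc _).
have dl x : U x -> differentiable (l \o f) x.
  move=> Ux; apply: differentiable_comp; first exact: (sf 1).1.
  exact: linear_differentiable.
split=> [x Ux|v].
  by apply: differentiableD (differentiable_cst _ _) (dl _ Ux).
have := (Ck_on_linear Uo lc (sf k.+1)).2 v.
apply: Ck_on_ext => // x Ux.
rewrite (_ : (fun y => _) = cst a + (l \o f)) // diffD //; last exact: dl.
by rewrite diff_cst /= add0r.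
Qed.

End Calculus.

Section ChainRule.
Import Order.TTheory GRing.Theory Num.Theory.
Import numFieldTopology.Exports numFieldNormedType.Exports.
Local Open Scope classical_set_scope.
Local Open Scope ring_scope.
Context {R : realType}.
Implicit Types U V W : normedModType R.

Lemma diff_left_inverse V W (f : V -> W) (g : W -> V) x v :
  differentiable f x -> differentiable g (f x) ->
  (\forall y \near x, g (f y) = y) -> 'd g (f x) ('d f x v) = v.
Proof.
move=> df dg fg.
have fg' : {near x, (g \o f) =1 id} by exact: fg.
have [_ e] := near_eq_is_diff fg' (differentiable_comp df dg).
have := diff_comp df dg; rewrite -e => /(congr1 (fun h => h v)) /= <-.
by rewrite diff_val.
Qed.

Lemma diff_lincomb V W (f g : V -> W) a x w :
  differentiable f x -> differentiable g x ->
  'd (fun y => a *: f y + g y) x w = a *: 'd f x w + 'd g x w.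
Proof.
move=> df dg; rewrite (_ : (fun y => _) = a *: f + g) //.
by rewrite diffD ?diffZ //; exact: differentiableZ.
Qed.

Lemma diff_sub V W (f g : V -> W) x w :
  differentiable f x -> differentiable g x ->
  'd (fun y => f y - g y) x w = 'd f x w - 'd g x w.
Proof. by move=> df dg; rewrite (_ : (fun y => _) = f - g) // diffB. Qed.

Lemma diff_partial2 U V W (F : U * V -> W) q p : differentiable F (q, p) ->
  differentiable (fun y => F (q, y)) p /\
  forall v, 'd (fun y => F (q, y)) p v = 'd F (q, p) (0, v).
Proof.
move=> dF; have dq : differentiable (fun y : V => (q, y)) p.
  exact: differentiable_pair.
split=> [|v]; first exact: (differentiable_comp (f := fun y : V => (q, y))).
rewrite (_ : (fun y => F (q, y)) = F \o (fun y : V => (q, y))) // diff_comp //=.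
by rewrite diff_pair // diff_cst diff_val.
Qed.

Lemma differentiable_partial1 U V W (F : U * V -> W) q p :
  differentiable F (q, p) -> differentiable (fun x => F (x, p)) q.
Proof.
by move=> dF; apply: (differentiable_comp (f := fun x : U => (x, p))).
Qed.

End ChainRule.

Section Limits.
Import Order.TTheory GRing.Theory Num.Theory.
Import numFieldTopology.Exports numFieldNormedType.Exports.
Local Open Scope classical_set_scope.
Local Open Scope ring_scope.
Context {R : realType}.

Lemma cvg_mulmx (T : Type) (F : set_system T) (FF : Filter F) (a b d : nat)
    (f : T -> 'M[R]_(a, b)) (g : T -> 'M[R]_(b, d))
    (A : 'M[R]_(a, b)) (B : 'M[R]_(b, d)) :
  f @ F --> A -> g @ F --> B -> (fun x => f x *m g x) @ F --> A *m B.
Proof.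
move=> fA gB; apply: cvg_mx => i j; rewrite mxE.
under eq_fun do rewrite mxE.
rewrite (_ : (fun x => _) = fun x => \sum_k f x i k * g x k j); last by [].
apply: cvg_big => [|k _]; first exact: add_continuous.
apply: cvgM.
  exact: (cvg_comp f (fun M : 'M[R]_(a, b) => M i k) fA
    (@coord_continuous _ _ _ i k A)).
exact: (cvg_comp g (fun M : 'M[R]_(b, d) => M k j) gB
  (@coord_continuous _ _ _ k j B)).
Qed.

(** At a zero of [f] the difference quotient of the product is the difference
    quotient of [f] times [H], so [H] need only be continuous. *)
Lemma is_derive_mulmx (V : normedModType R) (a d : nat) (f : V -> 'rV[R]_a)
    (H : V -> 'M[R]_(a, d)) p w :
  f p = 0 -> differentiable f p -> {for p, continuous H} ->
  is_derive p w (fun q => f q *m H q) ('d f p w *m H p).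
Proof.
move=> fp0 df cH.
suff h : (fun h => h^-1 *: (((fun q => f q *m H q) \o shift p) (h *: w) -
  f p *m H p)) @ 0^' --> 'd f p w *m H p.
  by apply: DeriveDef; [apply/cvg_ex; eexists; exact: h | exact: cvg_lim h].
rewrite fp0 mul0mx.
rewrite (_ : (fun h => _) = fun h =>
  (h^-1 *: (f (h *: w + p) - f p)) *m H (h *: w + p)); last first.
  by apply/funext => h /=; rewrite fp0 !subr0 scalemxAl.
apply: cvg_mulmx.
  by rewrite -deriveE //; exact: (diff_derivable df).
have shift_cvg : (fun h : R => h *: w + p) @ 0^' --> p.
  apply: cvg_within_filter.
  have : (fun h : R => h *: w + p) @ (0 : R) --> (0 *: w + p).
    by apply: cvgD; [exact: scalel_continuous | exact: cvg_cst].
  by rewrite scale0r add0r.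
exact: (cvg_comp (fun h : R => h *: w + p) H shift_cvg cH).
Qed.

(** If (f1 + i f2) H takes values in a complex subspace, so do its derivatives;
    at a zero of f1 + i f2 where H is the identity they are those of f1 + i f2.
    The subspace is cut out by the columns of its cokernel, which gives two
    real linear equations on the real and imaginary parts. *)
Lemma differential_in_subspace (V : normedModType R) (n a : nat)
    (E : 'M[R[i]]_(n, a)) (f1 f2 : V -> 'rV[R]_a) (H : V -> 'M[R]_a) p w :
  f1 p = 0 -> f2 p = 0 -> differentiable f1 p -> differentiable f2 p ->
  {for p, continuous H} -> H p = 1%:M ->
  (\forall q \near p, (cplx_mx (f1 q *m H q) (f2 q *m H q) <= E)%MS) ->
  (cplx_mx ('d f1 p w) ('d f2 p w) <= E)%MS.
Proof.
move=> f10 f20 df1 df2 cH Hp near_E.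
set N := cokermx E; pose N1 := re_mx N; pose N2 := im_mx N.
have cHN (B : 'M[R]_a) : {for p, continuous (fun q => H q *m B)}.
  by apply: cvg_mulmx cH _; exact: cvg_cst.
have der (f : V -> 'rV[R]_a) (B : 'M[R]_a) : f p = 0 -> differentiable f p ->
    is_derive p w (fun q => f q *m (H q *m B)) ('d f p w *m B).
  by move=> fp df; have := is_derive_mulmx w fp df (cHN B); rewrite Hp mul1mx.
have vanish (g : V -> 'rV[R]_a) l : (\forall q \near p, g q = 0) ->
    is_derive p w g l -> l = 0.
  move=> g0 dg; rewrite -(@derive_val _ _ _ _ _ _ _ dg).
  by rewrite (near_eq_derive _ g0) derive_cst.
have EN q : (cplx_mx (f1 q *m H q) (f2 q *m H q) <= E)%MS ->
    f1 q *m (H q *m N1) - f2 q *m (H q *m N2) = 0 /\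
    f1 q *m (H q *m N2) + f2 q *m (H q *m N1) = 0.
  rewrite submxE -/N -[N]cplx_re_im cplx_mulmx !mulmxA => /eqP /cplx_mx_eq0.
  by rewrite -/N1 -/N2.
rewrite submxE -/N -[N]cplx_re_im cplx_mulmx -/N1 -/N2.
have -> : 'd f1 p w *m N1 - 'd f2 p w *m N2 = 0.
  apply: vanish (is_deriveB (der f1 N1 f10 df1) (der f2 N2 f20 df2)).
  by apply: filterS near_E => q /EN[].
have -> : 'd f1 p w *m N2 + 'd f2 p w *m N1 = 0.
  apply: vanish (is_deriveD (der f1 N2 f10 df1) (der f2 N1 f20 df2)).
  by apply: filterS near_E => q /EN[].
by rewrite cplx_mx_real map_mx0.
Qed.

End Limits.

(** * The degree of a pure spinor *)

Section PureSpinors.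
Import GRing.Theory.
Local Open Scope ring_scope.
Context (m : nat) (F : fieldType).
Implicit Types (alpha beta rho : Defs.form m F) (S : {set 'I_m}).

Definition degree_ge k alpha := forall S, alpha S != 0 -> (k <= #|S|)%N.

Lemma degree_ge_wedge a b alpha beta :
  degree_ge a alpha -> degree_ge b beta -> degree_ge (a + b) (wedge alpha beta).
Proof.
move=> da db S; rewrite ffunE => nz.
have [A AS nzA] : exists2 A : {set 'I_m}, A \subset S &
    shuffle_sign A (S :\: A) * alpha A * beta (S :\: A) != 0.
  apply/exists_inP; apply: contraR nz => /exists_inPn h.
  by apply/eqP/big1 => A AS; apply/eqP; have := h A AS; rewrite negbK.
move: nzA; rewrite !mulf_eq0 !negb_or => /andP[/andP[_ /da leA] /db leB].
by rewrite -(cardsID A S) (finset.setIidPr AS) leq_add.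
Qed.

Lemma degree_ge_covector (xi : 'rV[F]_m) : degree_ge 1 (covector xi).
Proof.
move=> S; rewrite ffunE.
case: (finset.set_0Vmem S) => [-> |[i iS] _]; last first.
  by rewrite card_gt0; apply/finset.set0Pn; exists i.
rewrite big1 ?eqxx // => i /eqP/finset.setP/(_ i).
by rewrite !inE eqxx.
Qed.

Lemma degree_ge_wedge_all k (theta : 'I_k -> 'rV[F]_m) :
  degree_ge k (wedge_all theta).
Proof.
rewrite /wedge_all; elim: k theta => [//|k IH] theta.
rewrite big_ord_recl; apply: (@degree_ge_wedge 1); last exact: IH.
exact: degree_ge_covector.
Qed.

(** Let [S] be a set of least size with [rho S != 0]. The exterior part of the
    Clifford action only sees components of smaller degree at [S] minus a
    point, so the vectors of [A] contract the lowest-degree part of [rho] to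
    zero. If such a vector is supported in [S], its contraction evaluated at
    [S] minus i is plus or minus its i-th coordinate times [rho S]; hence it
    vanishes, and [A] meets the span of the e_i, i in [S], trivially. *)
Lemma rank_annihilator_spinor k rho p (A : 'M[F]_(p, m)) :
  rho != 0 -> degree_ge k rho ->
  (forall X, (X <= A)%MS -> exists xi, clifford (row_mx X xi) rho = 0) ->
  (\rank A + k <= m)%N.
Proof.
move=> nz dk annA.
have [S0 nzS0] : exists S, rho S != 0.
  apply/existsP; apply: contraR nz; rewrite negb_exists => /forallP h.
  by apply/eqP/ffunP=> S; rewrite ffunE; apply/eqP; have := h S; rewrite negbK.
case: (@arg_minnP _ S0 (fun S => rho S != 0) (fun S => #|S|) nzS0).
move=> S nzS minS.
apply: leq_trans (leq_add (leqnn _) (dk _ nzS)) _.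
pose B : 'M[F]_(#|S|, m) := rowsub enum_val 1%:M.
have rkB : \rank B = #|S|.
  apply/eqP; rewrite -/(row_free B); apply/row_freeP; exists B^T.
  apply/matrixP=> i j; rewrite mul_rowsub_mx mul1mx !mxE.
  by rewrite (inj_eq enum_val_inj) eq_sym.
have capAB : (A :&: B = 0)%MS.
  apply/eqP; rewrite -submx0; apply/rV_subP => X; rewrite sub_capmx submx0.
  case/andP=> /annA[xi annX] /submxP[u Xu].
  have X0 i : i \notin S -> X 0 i = 0.
    move=> iS; rewrite Xu !mxE big1 // => l _; rewrite !mxE.
    have [eli|] := eqVneq (enum_val l) i; last by rewrite mulr0.
    by rewrite -eli enum_valP in iS.
  apply/eqP/rowP => i; rewrite mxE.
  have [iS|] := boolP (i \in S); last exact: X0.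
  (* Only the term of [contract] that restores [i] can survive at [S :\ i]. *)
  have := congr1 (fun alpha : Defs.form m F => alpha (S :\ i)) annX.
  rewrite !ffunE row_mxKl row_mxKr [X in _ + X]big1 ?addr0; last first.
    move=> C CS; apply/eqP; rewrite mulf_eq0; apply/orP; right.
    apply: contraT => /minS; rewrite leqNgt => /negP[].
    apply: leq_ltn_trans (_ : #|S :\ i| < #|S|)%N.
      exact/subset_leq_card/finset.subsetDl.
    by rewrite [X in (_ < X)%N](cardsD1 i) iS.
  rewrite (bigD1 i) ?inE ?eqxx //= big1 ?addr0; last first.
    move=> l; rewrite !inE negb_and negbK => /andP[/orP[/eqP->|lS]].
      by rewrite eqxx.
    by move=> _; rewrite X0 // mulr0 mul0r.
  move=> /eqP; rewrite finset.setD1K // !mulf_eq0 (negPf nzS) orbF.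
  move=> /orP[|/eqP//].
  by rewrite expf_eq0 oppr_eq0 oner_eq0 andbF.
have := mxrank_sum_cap A B; rewrite capAB mxrank0 addn0 rkB => <-.
exact: rank_leq_col.
Qed.

End PureSpinors.

(** * Subalgebras of complexified nilpotent Lie algebras *)

(** Here [e i] and [g i] stand for the dimensions of E + g^i and g^i. Where
    [e] drops after an index above [j] it also drops just before, so its drops
    from [j] on fill an initial stretch [j, J) and [e] is constant from [J] to
    [s]. Comparing the codimension bound at [J] with the [J - j] unit drops of
    [g], and using [e j <= e 1 < m], bounds [g j] strictly by [e J = e s]. *)
Lemma jump_count (m : nat) (g e : nat -> nat) (s j : nat) : 0 < j <= s ->
  (forall i, e i.+1 <= e i) -> (forall i, 2 * (m - e i) <= m - g i) ->
  (forall i, e i <= m) ->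
  (forall i, j <= i < s -> g i = (g i.+1).+1) ->
  (forall i, j < i < s -> e i.+1 < e i -> e i < e i.-1) ->
  e 1 < m -> g j < e s.
Proof.
move=> /andP[j_gt0 le_js] e_decr codim e_le rkG e_jump e1.
have gE i : j <= i <= s -> g j = g i + (i - j).
  elim: i => [|i IH] /andP[le_ji lt_is]; first by lia.
  have [->|ne] := eqVneq j i.+1; first by rewrite subnn addn0.
  by rewrite IH ?(rkG i); lia.
have e_anti a b : a <= b -> e b <= e a.
  move=> /subnK <-; elim: (b - a) => [//|k]; exact/leq_trans/e_decr.
(* The last clause records that the stretch has not ended before [i], which is
   what a further drop at [i] is confronted with. *)
have jumps i : j <= i <= s -> exists J, [/\ j <= J <= i,
    e J = e i, e J + (J - j) <= e j & J < i -> e i = e i.-1].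
  elim: i => [|i IH] /andP[le_ji lt_is]; first by lia.
  have [ji|ne] := eqVneq j i.+1; first by exists i.+1; rewrite ji; split; lia.
  have [|J [ltJ eJ sJ cJ]] := IH; first by lia.
  have := e_decr i; rewrite leq_eqVlt => /orP[/eqP eW|ltW].
    by exists J; split=> //; lia.
  have [eJi|neJi] := eqVneq J i; first by exists i.+1; split; lia.
  have := e_jump i; lia.
have [|J [ltJ eJ sJ _]] := jumps s; first by lia.
have := codim J; have := gE J; have := e_le J; have := e_anti 1 j; lia.
Qed.

Section NilpotentBracket.
Import GRing.Theory.
Local Open Scope ring_scope.
Context (K : fieldType) (sigma : {rmorphism K -> K}) (m : nat).
Context (br : 'rV[K]_m -> 'rV[K]_m -> 'rV[K]_m) (G : nat -> 'M[K]_m).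
Context (E : 'M[K]_m).
Hypothesis sigmaK : involutive sigma.
Hypothesis brDl : forall x y z : 'rV[K]_m, br (x + y) z = br x z + br y z.
Hypothesis brC : forall x y, br x y = - br y x.
Hypothesis br_conj : forall x y,
  br (map_mx sigma x) (map_mx sigma y) = map_mx sigma (br x y).
Hypothesis G0 : row_full (G 0).
Hypothesis G_bracket : forall i x y, (x <= G i)%MS -> (br x y <= G i.+1)%MS.
Hypothesis G_span : forall i (W : 'M[K]_m),
  (forall x y, (x <= G i)%MS -> (br x y <= W)%MS) -> (G i.+1 <= W)%MS.
Hypothesis G_conj : forall i, (map_mx sigma (G i) :=: G i)%MS.
Hypothesis E_subalgebra : forall x y,
  (x <= E)%MS -> (y <= E)%MS -> (br x y <= E)%MS.
Hypothesis E_conj_full : row_full (E + map_mx sigma E)%MS.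

Definition bracket_le (A B W : 'M[K]_m) :=
  forall x y, (x <= A)%MS -> (y <= B)%MS -> (br x y <= W)%MS.

Lemma bracket_le_sym A B W : bracket_le A B W -> bracket_le B A W.
Proof. by move=> h x y xB yA; rewrite brC eqmx_opp; apply: h. Qed.

Lemma bracket_le_addl A A' B W :
  bracket_le A B W -> bracket_le A' B W -> bracket_le (A + A')%MS B W.
Proof.
move=> h h' x y /sub_addsmxP[u ->] yB.
by rewrite brDl addmx_sub //; [apply: h | apply: h'] => //; exact: submxMl.
Qed.

Lemma bracket_le_addr A B B' W :
  bracket_le A B W -> bracket_le A B' W -> bracket_le A (B + B')%MS W.
Proof.
move=> h h'; apply/bracket_le_sym/bracket_le_addl; exact/bracket_le_sym.
Qed.

Lemma bracket_leS A A' B B' W W' : (A <= A')%MS -> (B <= B')%MS ->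
  (W' <= W)%MS -> bracket_le A' B' W' -> bracket_le A B W.
Proof.
move=> sA sB sW h x y xA yB.
apply: submx_trans sW; apply: h; first exact: submx_trans sA.
exact: submx_trans sB.
Qed.

Lemma bracket_le_conj A B W : bracket_le A B W ->
  bracket_le (map_mx sigma A) (map_mx sigma B) (map_mx sigma W).
Proof.
have sK (p q : nat) (X : 'M[K]_(p, q)) : map_mx sigma (map_mx sigma X) = X.
  by apply/matrixP=> i j; rewrite !mxE sigmaK.
move=> h x y xA yB; rewrite -[x]sK -[y]sK br_conj map_submx; apply: h.
  by rewrite -[A]sK map_submx.
by rewrite -[B]sK map_submx.
Qed.

Lemma bracket_G i B : bracket_le (G i) B (G i.+1).
Proof. by move=> x y xG _; exact: G_bracket. Qed.

Lemma G_decreasing i : (G i.+1 <= G i)%MS.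
Proof.
elim: i => [|i IH]; first exact: submx_full.
by apply: G_span => x y xG; apply: G_bracket; apply: submx_trans IH.
Qed.

Lemma G_antitone i j : (i <= j)%N -> (G j <= G i)%MS.
Proof.
by move=> /subnK <-; elim: (j - i)%N => [//|k]; apply/submx_trans/G_decreasing.
Qed.

Local Notation W i := (E + G i)%MS.

Lemma W_decreasing i : (W i.+1 <= W i)%MS.
Proof. by rewrite addsmxS // G_decreasing. Qed.

(** A subalgebra that spans g modulo [g, g] is everything: if g = E + g^1 and
    g = E + g^i, then g^1 = [E + g^i, E + g^i] is inside E + g^(i+1), hence
    g = E + g^1 is too. *)
Lemma subalgebra_full i : row_full (W 1) -> row_full (W i).
Proof.
move=> W1; elim: i => [|i IH].
  by rewrite -sub1mx (submx_trans _ (addsmxSr _ _)) // sub1mx.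
have h : bracket_le (G 0) (W i) (W i.+1).
  apply: (@bracket_leS _ (W i) _ (W i) _ (W i.+1)) => //.
    exact: submx_full.
  apply: bracket_le_addl; apply: bracket_le_addr.
  - by move=> x y xE yE; rewrite (submx_trans _ (addsmxSl _ _)) // E_subalgebra.
  - apply/bracket_le_sym; apply: (bracket_leS _ _ _ (@bracket_G i E)) => //.
    exact: addsmxSr.
  - by apply: (bracket_leS _ _ _ (@bracket_G i E)) => //; exact: addsmxSr.
  - by apply: (bracket_leS _ _ _ (@bracket_G i (G i))) => //; exact: addsmxSr.
have G1 : (G 1 <= W i.+1)%MS.
  by apply: G_span => x y xG; apply: h xG _; exact: submx_full.
by rewrite -sub1mx (submx_trans (submx_full _ W1)) // addsmx_sub addsmxSl.
Qed.

(** Suppose the inclusion fails at the next step. As g^(i+1)/g^(i+2) is a line,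
    E meets g^(i+1) inside g^(i+2). Then
    [g^i, E] <= (E + g^(i+2)) /\ g^(i+1) = (E /\ g^(i+1)) + g^(i+2) = g^(i+2),
    and the same holds for the conjugate of E because the g^i are real. As E and
    its conjugate span, g^(i+1) = [g^i, g] <= g^(i+2), which is absurd. *)
Lemma stationary_step i : \rank (G i.+1) = (\rank (G i.+2)).+1 ->
  (G i <= W i.+1)%MS -> (G i.+1 <= W i.+2)%MS.
Proof.
move=> rkG GiW; case: (boolP (G i.+1 <= W i.+2)%MS) => // nG.
have EG : (E :&: G i.+1 <= G i.+2)%MS.
  apply/rV_subP => x; rewrite sub_capmx => /andP[xE xG].
  case: (boolP (x <= G i.+2)%MS) => // nx; case/negP: nG.
  have sxG : (x + G i.+2 <= G i.+1)%MS by rewrite addsmx_sub xG G_decreasing.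
  have : (G i.+1 <= x + G i.+2)%MS.
    rewrite -(geq_leqif (mxrank_leqif_sup sxG)) rkG.
    apply: rank_ltmx; rewrite /ltmx addsmxSr /=.
    by apply: contra nx; rewrite addsmx_sub => /andP[].
  by move/submx_trans; apply; rewrite addsmxS.
have h : bracket_le (G i) E (G i.+2).
  (* On one side [E + g^(i+1), E] <= E + g^(i+2). *)
  have hE : bracket_le (G i) E (W i.+2).
    apply: (bracket_leS GiW (submx_refl _) (submx_refl _)).
    apply: bracket_le_addl.
      move=> x y xE yE.
      by rewrite (submx_trans _ (addsmxSl _ _)) // E_subalgebra.
    by apply: (bracket_leS _ _ _ (@bracket_G i.+1 E)) => //; exact: addsmxSr.
  move=> x y xG yE; apply: (submx_trans _ (_ : (W i.+2 :&: G i.+1 <= _)%MS)).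
    by rewrite sub_capmx hE // G_bracket.
  by rewrite addsmxC -matrix_modl ?G_decreasing // addsmx_sub submx_refl.
have hc : bracket_le (G i) (map_mx sigma E) (G i.+2).
  by apply: (bracket_leS _ _ _ (bracket_le_conj h)); rewrite ?G_conj.
have : (G i.+1 <= G i.+2)%MS.
  apply: G_span => x y xG; apply: (bracket_le_addr h hc) xG _.
  exact: submx_full.
by move/mxrankS; rewrite rkG ltnn.
Qed.

(** E + g^i and its conjugate span the space and both contain g^i. *)
Lemma codim_W i : (2 * (m - \rank (W i)) <= m - \rank (G i))%N.
Proof.
have rs : \rank (map_mx sigma (W i)) = \rank (W i) by rewrite mxrank_map.
have full : \rank (W i + map_mx sigma (W i))%MS = m.
  apply/eqP; change (row_full (W i + map_mx sigma (W i))%MS).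
  rewrite -sub1mx (submx_trans (submx_full _ E_conj_full)) //.
  by rewrite addsmxS ?map_submx ?addsmxSl.
have := mxrank_sum_cap (W i) (map_mx sigma (W i)); rewrite full rs.
have : (\rank (G i) <= \rank (W i :&: map_mx sigma (W i))%MS)%N.
  apply: mxrankS; rewrite sub_capmx addsmxSr /=.
  by rewrite -(G_conj i) map_submx addsmxSr.
have := rank_leq_col (W i); lia.
Qed.

Lemma jump_below i : \rank (G i.+1) = (\rank (G i.+2)).+1 ->
  (\rank (W i.+2) < \rank (W i.+1))%N -> (\rank (W i.+1) < \rank (W i))%N.
Proof.
move=> rkG; rewrite !ltnNge; apply: contra => le.
have GW : (G i <= W i.+1)%MS.
  apply: submx_trans (addsmxSr E _) _.
  by rewrite -(geq_leqif (mxrank_leqif_sup (W_decreasing i))).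
by apply: mxrankS; rewrite addsmx_sub addsmxSl stationary_step.
Qed.

Lemma G1_proper s : (0 < m)%N -> \rank (G s) = 0 -> (\rank (G 1) < m)%N.
Proof.
move=> m_gt0 Gs0; rewrite ltn_neqAle rank_leq_col andbT; apply/negP=> /eqP G1.
have : row_full (G s).
  elim: (s) => // i IH; rewrite -sub1mx.
  apply: (submx_trans (submx_full _ (_ : row_full (G 1)))); first exact/eqP.
  by apply: G_span => x y _; apply: G_bracket; apply: submx_full.
by rewrite /row_full Gs0 eq_sym gtn_eqF.
Qed.

(** The algebraic heart of the theorem: a complex subalgebra E that spans with
    its conjugate has codimension less than codim g^j, as soon as all the
    quotients of the lower central series from g^j on are lines. *)
Lemma rank_subalgebra_gt s j : (0 < m)%N -> (0 < j <= s)%N -> \rank (G s) = 0 ->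
  (forall i, (j <= i < s)%N -> \rank (G i) = (\rank (G i.+1)).+1) ->
  (\rank (G j) < \rank E)%N.
Proof.
move=> m_gt0 js Gs0 rkG.
have Ws : \rank (W s) = \rank E.
  have /eqP -> : G s == 0 by rewrite -mxrank_eq0 Gs0.
  by rewrite addsmx0.
have [W1|W1] := boolP (row_full (W 1)).
  rewrite -Ws; have /eqP -> := subalgebra_full s W1.
  apply: leq_ltn_trans (G1_proper m_gt0 Gs0).
  by apply/mxrankS/G_antitone; case/andP: js.
rewrite -Ws.
apply: (@jump_count m (fun i => \rank (G i)) (fun i => \rank (W i)) s j) => //.
- by move=> i; apply/mxrankS/W_decreasing.
- by move=> i; apply: codim_W.
- by move=> i; apply: rank_leq_col.
- case=> [|i] ji; first by move: js ji; case: (j).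
  by apply: jump_below; apply: rkG; move: ji => /andP[/ltnW-> ->].
- by rewrite ltn_neqAle rank_leq_col andbT.
Qed.

End NilpotentBracket.

(** * Left-invariant vector fields in a chart *)

Section InvariantFields.
Import Order.TTheory GRing.Theory Num.Theory.
Import numFieldTopology.Exports numFieldNormedType.Exports.
Local Open Scope classical_set_scope.
Local Open Scope ring_scope.
Context {R : realType} {m : nat} (G : lieGroup R m) (c : chart R m G).
Local Notation E := 'rV[R]_m.
Local Notation e := (gone G).
Hypotheses (c_atlas : atlas c) (c_one : dom c e).

Lemma gmulrV (x : G) : gmul x (ginv x) = e.
Proof.
rewrite -[gmul x _]gmul1 -(gmulV (ginv x)) -gmulA.
by rewrite [gmul (ginv x) _]gmulA gmulV gmul1 gmulV.
Qed.

Lemma gmulr1 (x : G) : gmul x e = x.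
Proof. by rewrite -(gmulV x) gmulA gmulrV gmul1. Qed.

Lemma ginv1 : ginv e = e.
Proof. by rewrite -[ginv e]gmulr1 gmulV. Qed.

Let c_ok := atlas_ok c_atlas.
Local Notation p0 := (cmap c e).

Lemma dom_cinv q : cod c q -> dom c (cinv c q).
Proof. by move=> [x dx <-]; rewrite (cmapK c_ok). Qed.

Lemma cinvK q : cod c q -> cmap c (cinv c q) = q.
Proof. by move=> [x dx <-]; rewrite (cmapK c_ok). Qed.

Lemma cod_cmap x : dom c x -> cod c (cmap c x).
Proof. by move=> dx; exists x. Qed.

Lemma cinv_p0 : cinv c p0 = e.
Proof. exact: (cmapK c_ok). Qed.

Let cod0 : cod c p0. Proof. exact: cod_cmap. Qed.

Lemma near_cod : \forall q \near p0, cod c q.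
Proof. by apply: open_nbhs_nbhs; split => //; exact: (open_cod c_ok). Qed.

Lemma continuous_cinv0 : {for p0, continuous (cinv c)}.
Proof. exact: (continuous_cinv c_ok). Qed.

Let F (pq : E * E) : E := cmap c (gmul (cinv c pq.1) (cinv c pq.2)).

Let F_C2 q p : cod c q -> cod c p -> dom c (gmul (cinv c q) (cinv c p)) ->
  differentiable F (q, p) /\
  forall v, differentiable (fun y => 'd F y v) (q, p).
Proof.
move=> cq cp d; have sF := gmul_smooth c_atlas c_atlas c_atlas.
have Dqp : ((fun xy : G * G => (cmap c xy.1, cmap c xy.2)) @`
    [set xy | [/\ dom c xy.1, dom c xy.2 & dom c (gmul xy.1 xy.2)]]) (q, p).
  exists (cinv c q, cinv c p); last by rewrite /= !cinvK.
  by split => //=; exact: dom_cinv.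
by split=> [|v]; [exact: (sF 1).1 | exact: ((sF 2).2 v).1].
Qed.

Let F_C2_unit q : cod c q ->
  differentiable F (q, p0) /\
  forall v, differentiable (fun y => 'd F y v) (q, p0).
Proof.
by move=> cq; apply: F_C2; rewrite // cinv_p0 gmulr1; exact: dom_cinv.
Qed.

Local Notation B := (left_invariant_field c).

Let B_partial v q : cod c q -> B v q = 'd F (q, p0) (0, v).
Proof.
by move=> cq; have [_ h] := diff_partial2 (F_C2_unit cq).1; rewrite -h.
Qed.

(** The field is a partial derivative of the multiplication map, which is twice
    differentiable. *)
Lemma left_invariant_field_differentiable v : differentiable (B v) p0.
Proof.
have dF := differentiable_partial1 ((F_C2_unit cod0).2 (0, v)).
have nF : {near p0, (fun x => 'd F (x, p0) (0, v)) =1 B v}.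
  by apply: filterS near_cod => q cq; rewrite B_partial.
by have [] := near_eq_is_diff nF dF.
Qed.

Lemma left_invariant_field_one v : B v p0 = v.
Proof.
rewrite /left_invariant_field cinv_p0.
have nid : {near p0, id =1 cmap c \o gmul e \o cinv c}.
  by apply: filterS near_cod => q cq; rewrite /= gmul1 cinvK.
have [_ ->] := near_eq_is_diff nid (ex_diff (f := id)).
by rewrite diff_val.
Qed.

Lemma left_invariant_fieldP a u v :
  B (a *: u + v) = fun q => a *: B u q + B v q.
Proof.
apply/funext => q.
exact: (linearP ('d (cmap c \o gmul (cinv c q) \o cinv c) p0)).
Qed.

Lemma lie_bracketE u v :
  lie_bracket c u v = 'd (B v) p0 u - 'd (B u) p0 v.
Proof. by rewrite /lie_bracket /lie !left_invariant_field_one. Qed.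

Lemma lie_bracketC u v : lie_bracket c u v = - lie_bracket c v u.
Proof. by rewrite !lie_bracketE opprB. Qed.

Lemma lie_bracketPl a u v w : lie_bracket c (a *: u + v) w =
  a *: lie_bracket c u w + lie_bracket c v w.
Proof.
pose dB := left_invariant_field_differentiable.
have lin : 'd (B w) p0 (a *: u + v) = a *: 'd (B w) p0 u + 'd (B w) p0 v.
  exact: linearP.
have dlin : 'd (B (a *: u + v)) p0 w = a *: 'd (B u) p0 w + 'd (B v) p0 w.
  by rewrite left_invariant_fieldP; exact: diff_lincomb.
have regroup (V : lmodType R) (x y z t : V) :
    (a *: x + y) - (a *: z + t) = a *: (x - z) + (y - t).
  by rewrite scalerBr opprD addrACA.
rewrite !lie_bracketE -regroup; exact: (congr2 (fun x y => x - y) lin dlin).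
Qed.

(** Brings tangent vectors at the point of coordinates [q] back to the Lie
    algebra, by the inverse of the left translation to this point. *)
Definition to_identity (q : E) : 'M[R]_m :=
  jac (gmul (ginv (cinv c q))) c c (cinv c q).

Lemma near_dom_ginv : \forall q \near p0, cod c q /\ dom c (ginv (cinv c q)).
Proof.
have ci : {for p0, continuous (fun q => ginv (cinv c q))}.
  apply: continuous_comp; first exact: continuous_cinv0.
  exact: (@ginv_smooth _ _ G).1.
have : \forall q \near p0, dom c (ginv (cinv c q)).
  apply: ci; apply: open_nbhs_nbhs; split; first exact: (open_dom c_ok).
  by rewrite cinv_p0 ginv1.
by apply: filterS2 near_cod => q.
Qed.

(** The field at the point a is the image of its value at the identity by the
    differential of the translation by a; composing with the translation by
    the inverse of a gives the identity near the identity element. *)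
Lemma left_invariant_fieldK v :
  \forall q \near p0, B v q *m to_identity q = v.
Proof.
apply: filterS near_dom_ginv => q [cq dq].
set a := cinv c q in dq *.
have ca : cmap c a = q by exact: cinvK.
rewrite /to_identity /jac /jacobian mul_rV_lin1 -/a ca.
set g := cmap c \o gmul a \o cinv c; set h := cmap c \o _ \o cinv c.
have gp0 : g p0 = q by rewrite /g /= cinv_p0 gmulr1.
rewrite -[q in 'd _ q]gp0; apply: diff_left_inverse.
- exact: (diff_partial2 (F_C2_unit cq).1).1.
- rewrite gp0; have := @F_C2 (cmap c (ginv a)) q (cod_cmap dq) cq.
  rewrite (cmapK c_ok dq) gmulV => /(_ c_one)[/diff_partial2[+ _] _].
  by rewrite /F /= (cmapK c_ok dq).
have ga : {for p0, continuous (gmul a \o cinv c)}.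
  apply: continuous_comp; first exact: continuous_cinv0.
  apply: (continuous_comp (f := fun x => (a, x))
    (g := fun xy : G * G => gmul xy.1 xy.2)).
    by apply: cvg_pair; [exact: cvg_cst | exact: cvg_id].
  exact: gmul_continuous.
have : \forall p \near p0, dom c (gmul a (cinv c p)).
  apply: ga; apply: open_nbhs_nbhs; split; first exact: (open_dom c_ok).
  by rewrite /= cinv_p0 gmulr1; exact: dom_cinv.
apply: filterS2 near_cod => p cp dp.
by rewrite /h /g /= (cmapK c_ok dp) gmulA gmulV gmul1 cinvK.
Qed.

Lemma to_identity_one : to_identity p0 = 1%:M.
Proof.
apply/row_matrixP => i; rewrite !rowE mulmx1.
have := nbhs_singleton (left_invariant_fieldK (delta_mx 0 i)).
by rewrite left_invariant_field_one.
Qed.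

(** Near the identity [to_identity q] is a partial derivative of the
    multiplication map at the point with coordinates of (a^-1, a), which
    depends continuously on a. *)
Lemma to_identity_continuous : {for p0, continuous to_identity}.
Proof.
pose i0 q := cmap c (ginv (cinv c q)).
have ci0 : {for p0, continuous i0}.
  apply: (@continuous_comp _ _ _ (fun q => ginv (cinv c q)) (cmap c)).
    apply: continuous_comp; first exact: continuous_cinv0.
    exact: (@ginv_smooth _ _ G).1.
  by apply: (continuous_cmap c_ok); rewrite cinv_p0 ginv1.
have ci : {for p0, continuous (fun q => (i0 q, q))}.
  apply: (@cvg_pair _ _ _ (nbhs p0) (nbhs (i0 p0)) (nbhs p0) _ _ _ i0 id).
    exact: ci0.
  by move=> A.
have i00 : i0 p0 = p0 by rewrite /i0 cinv_p0 ginv1.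
apply: (@continuous_mx R _ m m to_identity p0) => i j.
have dc := differentiable_continuous ((F_C2_unit cod0).2 (0, delta_mx 0 i)).
have ci' : (fun q => (i0 q, q)) @ p0 --> (p0, p0).
  by move: ci; rewrite /prop_for /continuous_at i00.
have c1 : 'd F (i0 q, q) (0, delta_mx 0 i) @[q --> p0] -->
    'd F (p0, p0) (0, delta_mx 0 i).
  exact: (cvg_comp (fun q => (i0 q, q))
    (fun y => 'd F y (0, delta_mx 0 i)) ci' dc).
have cd : {for p0, continuous (fun q => 'd F (i0 q, q) (0, delta_mx 0 i) 0 j)}.
  rewrite /prop_for /continuous_at i00.
  exact: (cvg_comp _ (fun N : E => N 0 j) c1 (@coord_continuous _ _ _ 0 j _)).
have nT : {near p0, (fun q => 'd F (i0 q, q) (0, delta_mx 0 i) 0 j) =1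
    (fun q => to_identity q i j)}.
  apply: filterS near_dom_ginv => q [cq dq].
  have dF : differentiable F (i0 q, q).
    apply: (F_C2 _ _ _).1 => //; first exact: cod_cmap.
    by rewrite (cmapK c_ok dq) gmulV.
  have [_ h] := diff_partial2 dF.
  apply: (etrans (congr1 (fun N : E => N 0 j) (esym (h (delta_mx 0 i))))).
  have <- : cmap c \o gmul (ginv (cinv c q)) \o cinv c = (fun y => F (i0 q, y)).
    by apply/funext => y; rewrite /F /= /i0 (cmapK c_ok dq).
  rewrite /to_identity /jac (cinvK cq) /jacobian.
  exact/esym/mxE.
exact: near_eq_continuous nT cd.
Qed.

End InvariantFields.

(** * The +i-eigenspace and its involutivity *)

Section Eigenspace.
Import Order.TTheory GRing.Theory Num.Theory.
Local Open Scope ring_scope.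
Local Open Scope complex_scope.
Context {R : realType} {m : nat}.
Local Notation C := R[i].
Local Notation toC := (map_mx (real_complex R)).
Implicit Types J : 'M[R]_(m + m).

Lemma eigLP J n (u : 'M[C]_(n, m + m)) :
  reflect (u *m toC J = 'i *: u) (u <= eigL J)%MS.
Proof. by rewrite /eigL cplx_mx_real; exact: eigenspaceP. Qed.

Lemma eigL_intertwine J J' g (u : 'rV[C]_(m + m)) : J *m g = g *m J' ->
  (u <= eigL J)%MS -> (u *m toC g <= eigL J')%MS.
Proof.
move=> Jg /eigLP uJ; apply/eigLP.
by rewrite -mulmxA -map_mxM -Jg map_mxM mulmxA uJ scalemxAl.
Qed.

Lemma lsubmx_submx n (L : 'M[C]_(n, m + m)) (u : 'rV[C]_(m + m)) :
  (u <= L)%MS -> (lsubmx u <= lsubmx L)%MS.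
Proof. by move=> /submxP[a ->]; rewrite -mulmx_lsub submxMl. Qed.

Lemma lsubmx_submxP n (L : 'M[C]_(n, m + m)) (x : 'rV[C]_m) :
  (x <= lsubmx L)%MS -> exists2 u, (u <= L)%MS & lsubmx u = x.
Proof.
by move=> /submxP[a ->]; exists (a *m L); rewrite ?submxMl // mulmx_lsub.
Qed.

(** Twice the projection onto the +i-eigenspace, u - i u J, spelled out on real
    and imaginary parts because smoothness is a condition on these. *)
Definition eig_proj J (u : 'rV[C]_(m + m)) : 'rV[C]_(m + m) :=
  cplx_mx (re_mx u + im_mx u *m J) (im_mx u - re_mx u *m J).

Lemma eig_projE J u : eig_proj J u = u - 'i *: (u *m toC J).
Proof.
rewrite -[u in RHS]cplx_re_im -cplx_mx_real cplx_mulmx !mulmx0 subr0 add0r.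
by rewrite cplx_mxZi cplx_mxN cplx_mxD opprK.
Qed.

Lemma eig_proj_eigL J u : J *m J = - 1%:M -> (eig_proj J u <= eigL J)%MS.
Proof.
move=> JJ; apply/eigLP; rewrite eig_projE mulmxBl -scalemxAl -mulmxA.
rewrite -map_mxM JJ map_mxN map_mx1 mulmxN mulmx1 scalerN opprK scalerBr.
by rewrite scalerA -expr2 sqr_i scaleN1r opprK addrC.
Qed.

Lemma eig_proj_id J u : (u <= eigL J)%MS -> eig_proj J u = u *+ 2.
Proof.
move=> /eigLP uJ; rewrite eig_projE uJ scalerA -expr2 sqr_i scaleN1r opprK.
by rewrite mulr2n.
Qed.

(** As J^2 = -1, every u is the half sum of u - i u J, in L, and u + i u J, in
    the conjugate of L. *)
Lemma eigL_conj_full J : J *m J = - 1%:M ->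
  row_full (lsubmx (eigL J) + map_mx (@conjc R) (lsubmx (eigL J)))%MS.
Proof.
move=> JJ; rewrite -sub1mx; apply/rV_subP => x _.
have two0 : (2 : C) != 0 by rewrite pnatr_eq0.
pose v : 'rV[C]_(m + m) := row_mx x 0.
have -> : x = 2^-1 *: (lsubmx (eig_proj J v) + lsubmx (v *+ 2 - eig_proj J v)).
  rewrite -linearD /= addrC subrK linearMn /= row_mxKl.
  by rewrite -[x *+ 2]scaler_nat scalerA mulVf // scale1r.
apply/scalemx_sub/addmx_sub.
  by apply: submx_trans (addsmxSl _ _); exact/lsubmx_submx/eig_proj_eigL.
apply: submx_trans (addsmxSr _ _).
have conjK (a b : nat) (A : 'M[C]_(a, b)) :
    map_mx (@conjc R) (map_mx (@conjc R) A) = A.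
  by apply/matrixP => i j; rewrite !mxE conjcK.
rewrite -[X in (X <= _)%MS]conjK map_submx map_lsubmx.
apply: lsubmx_submx.
have -> : map_mx (@conjc R) (v *+ 2 - eig_proj J v) =
    eig_proj J (map_mx (@conjc R) v).
  rewrite !eig_projE mulr2n opprB addrACA subrr addr0 map_mxD map_mxZ map_mxM.
  have -> : map_mx (@conjc R) (toC J) = toC J.
    by apply/matrixP => i j; rewrite !mxE conjc_real.
  rewrite /= -scaleNr; congr (_ + _ *: _); apply/eqP.
  by rewrite eq_complex /= oppr0 !eqxx.
exact: eig_proj_eigL.
Qed.

End Eigenspace.

Section Integrability.
Import Order.TTheory GRing.Theory Num.Theory.
Import numFieldTopology.Exports numFieldNormedType.Exports.
Local Open Scope classical_set_scope.
Local Open Scope ring_scope.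
Local Open Scope complex_scope.
Context {R : realType} {m : nat} (G : lieGroup R m) (c : chart R m G).
Local Notation E := 'rV[R]_m.
Local Notation C := R[i].
Local Notation e := (gone G).
Hypotheses (c_atlas : atlas c) (c_one : dom c e).
Context (J : endo_field G).
Hypotheses (gcJ : generalized_complex J) (invJ : left_invariant J).
Local Notation p0 := (cmap c e).
Local Notation B := (left_invariant_field c).
Local Notation T := (to_identity c).
Let c_ok := atlas_ok c_atlas.

(** The projection to the complexified Lie algebra of the +i-eigenspace at the
    identity. *)
Definition holomorphic_part : 'M[C]_(m + m, m) := lsubmx (eigL (J c p0)).
Local Notation L1 := holomorphic_part.

(** Left-invariance at the point a, for the translation by the inverse of a. *)
Lemma transport_holomorphic_part :
  \forall q \near p0, forall u : 'rV[C]_(m + m), (u <= eigL (J c q))%MS ->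
    (cplx_mx (lsubmx (re_mx u) *m T q) (lsubmx (im_mx u) *m T q) <= L1)%MS.
Proof.
apply: filterS (near_dom_ginv c_atlas c_one) => q [cq dq] u uL.
set a := cinv c q in dq *.
have := invJ (a := ginv a) c_atlas c_atlas (dom_cinv c_atlas cq).
rewrite -/a gmulV (cinvK c_atlas cq) => /(_ c_one) inter.
have /lsubmx_submx := eigL_intertwine inter uL.
congr (_ <= _)%MS.
rewrite /gjac -/a -/(to_identity c q) -cplx_mx_real.
rewrite -[u in LHS]cplx_re_im cplx_mulmx.
rewrite !mulmx0 subr0 add0r lsubmx_cplx.
by rewrite -[re_mx u in LHS]hsubmxK -[im_mx u in LHS]hsubmxK !mul_row_block
  !mulmx0 !addr0 !row_mxKl.
Qed.

Section Sections.
Context (u : 'rV[C]_(m + m)).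
(** A section of L through any given vector of L at the identity, up to the
    factor 2. It is smooth because J is; it is not left-invariant. *)
Definition eig_section (q : E) := eig_proj (J c q) u.
Definition sec_re q : E := lsubmx (re_mx (eig_section q)).
Definition sec_im q : E := lsubmx (im_mx (eig_section q)).

Lemma eig_section_smooth : smoothC_on (cod c) eig_section.
Proof.
have Jsmooth := gc_smooth gcJ c_atlas.
have mulc (a : 'rV[R]_(m + m)) : continuous (mulmx a : 'M[R]_(m + m) -> _).
  move=> x; apply: (@cvg_mulmx R _ (nbhs x) _ _ _ _ (fun=> a) id a x).
    exact: cvg_cst.
  by move=> A.
split.
  rewrite (_ : (fun q => _) =
    fun q => re_mx u + mulmx (im_mx u) (J c q)); last first.
    by apply/funext => q; rewrite /eig_section re_cplx.
  exact: smooth_on_affine (open_cod c_ok) (mulc _) Jsmooth.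
rewrite (_ : (fun q => _) =
  fun q => im_mx u + mulmx (- re_mx u) (J c q)); last first.
  by apply/funext => q; rewrite /eig_section im_cplx mulNmx.
exact: smooth_on_affine (open_cod c_ok) (mulc _) Jsmooth.
Qed.

Lemma eig_section_eigL q : cod c q -> (eig_section q <= eigL (J c q))%MS.
Proof. by move=> cq; apply/eig_proj_eigL/(gc_square gcJ c_atlas cq). Qed.

Lemma sec_re_differentiable : differentiable sec_re p0.
Proof.
apply: (differentiable_comp (f := fun q => re_mx (eig_section q))
  (g := lsubmx)).
  exact: (eig_section_smooth.1 1).1 (cod_cmap c_one).
exact: differentiable_lsubmx.
Qed.

Lemma sec_im_differentiable : differentiable sec_im p0.
Proof.
apply: (differentiable_comp (f := fun q => im_mx (eig_section q))
  (g := lsubmx)).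
  exact: (eig_section_smooth.2 1).1 (cod_cmap c_one).
exact: differentiable_lsubmx.
Qed.

(** How far, to first order at the identity, the vector part of the section is
    from the left-invariant field with the same value there. *)
Definition dev_re w := 'd sec_re p0 w - 'd (B (sec_re p0)) p0 w.
Definition dev_im w := 'd sec_im p0 w - 'd (B (sec_im p0)) p0 w.

(** Moved back to the identity by left translations, the section takes its
    values in the holomorphic part, and the left-invariant field becomes
    constant. *)
Lemma deviation_holomorphic w : (cplx_mx (dev_re w) (dev_im w) <= L1)%MS.
Proof.
have dB v := left_invariant_field_differentiable c_atlas c_one v.
pose f1 q := sec_re q - B (sec_re p0) q.
pose f2 q := sec_im q - B (sec_im p0) q.
have d1 : 'd f1 p0 w = dev_re w := diff_sub w sec_re_differentiable (dB _).
have d2 : 'd f2 p0 w = dev_im w := diff_sub w sec_im_differentiable (dB _).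
rewrite -d1 -d2; apply: (differential_in_subspace (H := T)).
- by rewrite /f1 left_invariant_field_one // subrr.
- by rewrite /f2 left_invariant_field_one // subrr.
- exact: differentiableB sec_re_differentiable (dB _).
- exact: differentiableB sec_im_differentiable (dB _).
- exact: to_identity_continuous.
- exact: to_identity_one.
have L0 : (cplx_mx (sec_re p0) (sec_im p0) <= L1)%MS.
  rewrite -lsubmx_cplx cplx_re_im; apply: lsubmx_submx.
  exact: eig_section_eigL (cod_cmap c_one).
have nT1 := left_invariant_fieldK c_atlas c_one (sec_re p0).
have nT2 := left_invariant_fieldK c_atlas c_one (sec_im p0).
near=> q.
have cq : cod c q by near: q; exact: near_cod.
have -> : f1 q *m T q = sec_re q *m T q - sec_re p0.
  by rewrite mulmxBl; congr (_ - _); near: q; exact: nT1.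
have -> : f2 q *m T q = sec_im q *m T q - sec_im p0.
  by rewrite mulmxBl; congr (_ - _); near: q; exact: nT2.
rewrite -cplx_mxD -cplx_mxN addmx_sub ?eqmx_opp //.
have H : forall u : 'rV[C]_(m + m), (u <= eigL (J c q))%MS ->
    (cplx_mx (lsubmx (re_mx u) *m T q) (lsubmx (im_mx u) *m T q) <= L1)%MS.
  by near: q; exact: transport_holomorphic_part.
exact/H/eig_section_eigL.
Unshelve. all: by end_near. Qed.

End Sections.

Lemma lsubmx_courantC (s t : E -> 'rV[C]_(m + m)) p :
  let s1 q := lsubmx (re_mx (s q)) in let s2 q := lsubmx (im_mx (s q)) in
  let t1 q := lsubmx (re_mx (t q)) in let t2 q := lsubmx (im_mx (t q)) in
  lsubmx (courantC s t p) =
  cplx_mx (lie s1 t1 p - lie s2 t2 p) (lie s1 t2 p + lie s2 t1 p).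
Proof.
have lsB (a b : 'rV[R]_(m + m)) : lsubmx (a - b) = lsubmx a - lsubmx b.
  exact: linearB.
have lsD (a b : 'rV[R]_(m + m)) : lsubmx (a + b) = lsubmx a + lsubmx b.
  exact: linearD.
rewrite /= /courantC lsubmx_cplx lsB lsD.
by congr (cplx_mx (_ - _) (_ + _)); exact: row_mxKl.
Qed.

(** The bracket of two fields depends on their first jets; it differs from that
    of the left-invariant fields with the same values by the derivatives of
    the deviations. *)
Lemma lie_sections (X Y : E -> E) (gX gY : E -> E) :
  (forall w, gX w = 'd X p0 w - 'd (B (X p0)) p0 w) ->
  (forall w, gY w = 'd Y p0 w - 'd (B (Y p0)) p0 w) ->
  lie X Y p0 = lie_bracket c (X p0) (Y p0) + gY (X p0) - gX (Y p0).
Proof.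
move=> hX hY; rewrite hX hY lie_bracketE // /lie.
have regroup (V : zmodType) (a b x y : V) : a - b = x - y + (a - x) - (b - y).
  by rewrite opprB [x - y + _]addrC !subrKA.
exact: regroup.
Qed.

(** [u1 + i u1'], ... are values of the complex deviations at real vectors; in
    the complex bracket they only enter through complex combinations. *)
Lemma cancel_deviation n (L : 'M[C]_(n, m)) (b11 b22 b12 b21 : E)
    (v1 v1' v2 v2' u1 u1' u2 u2' : E) :
  (cplx_mx v1 v1' <= L)%MS -> (cplx_mx v2 v2' <= L)%MS ->
  (cplx_mx u1 u1' <= L)%MS -> (cplx_mx u2 u2' <= L)%MS ->
  (cplx_mx ((b11 + v1 - u1) - (b22 + v2' - u2'))
     ((b12 + v1' - u2) + (b21 + v2 - u1')) <= L)%MS ->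
  (cplx_mx (b11 - b22) (b12 + b21) <= L)%MS.
Proof.
move=> hv1 hv2 hu1 hu2 h.
set Y := cplx_mx _ _ in h.
have -> : cplx_mx (b11 - b22) (b12 + b21) = Y
    + (cplx_mx u1 u1' + 'i *: cplx_mx u2 u2')
    - (cplx_mx v1 v1' + 'i *: cplx_mx v2 v2').
  rewrite !cplx_mxZi !cplx_mxD cplx_mxN /Y cplx_mxD.
  by congr cplx_mx; apply/matrixP => i j; rewrite !mxE; ring.
by rewrite !(addmx_sub, eqmx_opp, scalemx_sub).
Qed.

Definition complex_bracket (x y : 'rV[C]_m) : 'rV[C]_m :=
  cplx_mx
    (lie_bracket c (re_mx x) (re_mx y) - lie_bracket c (im_mx x) (im_mx y))
    (lie_bracket c (re_mx x) (im_mx y) + lie_bracket c (im_mx x) (re_mx y)).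

(** The vector part of the Courant bracket of two sections of L is the bracket
    of their vector parts, so involutivity puts it in the holomorphic part.
    Replacing the sections by left-invariant fields changes it by derivatives
    of deviations, which lie there too. *)
Lemma holomorphic_part_subalgebra x y :
  (x <= L1)%MS -> (y <= L1)%MS -> (complex_bracket x y <= L1)%MS.
Proof.
have two0 : (2 : C) != 0 by rewrite pnatr_eq0.
have half (z : 'rV[C]_m) : (z <= L1)%MS ->
    exists u, cplx_mx (sec_re u p0) (sec_im u p0) = z.
  move=> /lsubmx_submxP[v vL <-]; exists (2^-1 *: v).
  rewrite -lsubmx_cplx cplx_re_im /eig_section eig_proj_id ?scalemx_sub //.
  by rewrite -[_ *+ 2]scaler_nat scalerA mulfV // scale1r.
move=> /half[u <-] /half[v <-].
have cod0 := cod_cmap c_one : cod c p0.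
have /lsubmx_submx := gc_integrable gcJ c_atlas
  (open_cod c_ok) (@subset_refl _ _)
  (eig_section_smooth u) (eig_section_smooth v)
  (eig_section_eigL u) (eig_section_eigL v) cod0.
rewrite lsubmx_courantC.
have e11 : lie (sec_re u) (sec_re v) p0 = _ :=
  lie_sections (frefl (dev_re u)) (frefl (dev_re v)).
have e22 : lie (sec_im u) (sec_im v) p0 = _ :=
  lie_sections (frefl (dev_im u)) (frefl (dev_im v)).
have e12 : lie (sec_re u) (sec_im v) p0 = _ :=
  lie_sections (frefl (dev_re u)) (frefl (dev_im v)).
have e21 : lie (sec_im u) (sec_re v) p0 = _ :=
  lie_sections (frefl (dev_im u)) (frefl (dev_re v)).
rewrite e11 e22 e12 e21 => courant_L1.
rewrite /complex_bracket !re_cplx !im_cplx.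
apply: (cancel_deviation (deviation_holomorphic v _) (deviation_holomorphic v _)
  (deviation_holomorphic u _) (deviation_holomorphic u _) courant_L1).
Qed.

End Integrability.

(** * The lower central series as row spaces *)

Section RowSubspaces.
Import GRing.Theory.
Local Open Scope ring_scope.
Context {F : fieldType} {m : nat}.
Implicit Types U : {vspace 'rV[F]_m}.

Definition vspace_mx U : 'M[F]_(\dim U, m) :=
  \matrix_(k < \dim U) (vbasis U)`_k.

Lemma dim_fullv_row : \dim {: 'rV[F]_m} = m.
Proof. by rewrite dimvf dim_matrix; exact: mul1n. Qed.

Lemma mem_vspace_mx U x : (x <= vspace_mx U)%MS = (x \in U).
Proof.
apply/idP/idP => [/submxP[a ->]|xU].
  rewrite mulmx_sum_row memv_suml // => k _; rewrite rowK memvZ //.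
  by apply: vbasis_mem; rewrite mem_nth ?size_tuple.
rewrite (coord_vbasis xU); apply: summx_sub => k _.
by rewrite scalemx_sub // -[_`_k](rowK (fun k : 'I__ => (vbasis U)`_k)) row_sub.
Qed.

Lemma rank_vspace_mx U : \rank (vspace_mx U) = \dim U.
Proof.
apply/eqP; rewrite -/(row_free _) -kermx_eq0; apply/rowV0P => a /sub_kermxP.
rewrite mulmx_sum_row => h.
have /freeP fU := basis_free (vbasisP U).
apply/rowP => k; rewrite mxE; apply: (fU (fun k => a 0 k)).
by rewrite -[RHS]h; apply: eq_bigr => l _; rewrite rowK.
Qed.

End RowSubspaces.

Section Annihilator.
Import GRing.Theory.
Local Open Scope ring_scope.
Context {R : realType} {m : nat}.
Implicit Types U : {vspace 'rV[R]_m}.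

Lemma mem_annihilator U xi :
  (xi \in annihilator U) = (xi *m (vspace_mx U)^T == 0).
Proof.
have evl (w : 'rV[R]_m) : linear (fun xi : 'rV[R]_m => Defs.eval xi w : R^o).
  move=> a u v; rewrite /Defs.eval scaler_sumr -big_split.
  apply: eq_bigr => l _.
  by rewrite !mxE mulrDl scalerAl.
have linE w x :
    linfun (fun xi : 'rV[R]_m => Defs.eval xi w : R^o) x = Defs.eval x w.
  pose lM := GRing.isLinear.Build _ _ _ _ _ (evl w).
  pose l : {linear 'rV[R]_m -> R^o} :=
    HB.pack (fun xi : 'rV[R]_m => Defs.eval xi w : R^o) lM.
  exact: (lfunE l).
have -> : (xi \in annihilator U) =
    all (fun w => Defs.eval xi w == 0) (vbasis U).
  rewrite /annihilator; elim: (tval (vbasis U)) => [|w s IH].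
    by rewrite big_nil memvf.
  by rewrite big_cons memv_cap memv_ker linE IH.
have entry (k : 'I_(\dim U)) :
    (xi *m (vspace_mx U)^T) 0 k = Defs.eval xi (vbasis U)`_k.
  by rewrite mxE; apply: eq_bigr => l _; rewrite !mxE.
apply/(all_nthP 0)/eqP => [h|h k].
  by apply/rowP => k; rewrite entry mxE; apply/eqP/h; rewrite size_tuple.
by rewrite size_tuple => kU; rewrite -[k]/(val (Ordinal kU)) -entry h mxE.
Qed.

Lemma dim_annihilator U : (\dim (annihilator U) + \dim U = m)%N.
Proof.
have <- : \rank (kermx (vspace_mx U)^T) = \dim (annihilator U).
  rewrite -(rank_vspace_mx (annihilator U)); apply/eqmx_rank/andP.
  split; apply/rV_subP => x.
    by move=> /sub_kermxP/eqP h; rewrite mem_vspace_mx mem_annihilator.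
  by rewrite mem_vspace_mx mem_annihilator => /eqP h; apply/sub_kermxP.
rewrite mxrank_ker mxrank_tr rank_vspace_mx subnK //.
by rewrite -(rank_vspace_mx U) rank_leq_col.
Qed.

End Annihilator.

Section LowerCentralSeries.
Import Order.TTheory GRing.Theory Num.Theory.
Local Open Scope ring_scope.
Local Open Scope complex_scope.
Context {R : realType} {m : nat} (G : lieGroup R m) (c : chart R m G).
Local Notation E := 'rV[R]_m.
Local Notation C := R[i].
Local Notation toC := (map_mx (real_complex R)).
Hypotheses (c_atlas : atlas c) (c_one : dom c (gone G)).
Local Notation br := (lie_bracket c).
Local Notation brC := (complex_bracket c).

Lemma lie_bracketDl u v w : br (u + v) w = br u w + br v w.
Proof. by have := lie_bracketPl c_atlas c_one 1 u v w; rewrite !scale1r. Qed.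

Lemma lie_bracket0l w : br 0 w = 0.
Proof. by apply: (addrI (br 0 w)); rewrite -lie_bracketDl !addr0. Qed.

Lemma lie_bracketZl a u w : br (a *: u) w = a *: br u w.
Proof.
have := lie_bracketPl c_atlas c_one a u 0 w.
by rewrite [a *: u + 0]addr0 lie_bracket0l [_ + 0]addr0.
Qed.

Lemma lie_bracketZr a u w : br w (a *: u) = a *: br w u.
Proof. by rewrite !(lie_bracketC c_atlas c_one w) lie_bracketZl scalerN. Qed.

Lemma lie_bracket_suml n (u : 'I_n -> E) w :
  br (\sum_k u k) w = \sum_k br (u k) w.
Proof.
apply: (big_morph (fun u => br u w)); first by move=> x y; exact: lie_bracketDl.
exact: lie_bracket0l.
Qed.

Lemma lie_bracket_sumr n (u : 'I_n -> E) w :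
  br w (\sum_k u k) = \sum_k br w (u k).
Proof.
rewrite (lie_bracketC c_atlas c_one) lie_bracket_suml -sumrN.
by apply: eq_bigr => k _; rewrite -(lie_bracketC c_atlas c_one).
Qed.

Lemma lower_central_bracket i u v : u \in lower_central c i ->
  br u v \in lower_central c i.+1.
Proof.
move=> uL; rewrite (coord_vbasis uL) (coord_vbasis (memvf v)).
rewrite lie_bracket_suml memv_suml // => k _.
rewrite lie_bracketZl memvZ // lie_bracket_sumr memv_suml // => l _.
rewrite lie_bracketZr memvZ //; apply: memv_span.
by apply: allpairs_f; rewrite mem_nth // size_tuple.
Qed.

Lemma complex_bracketDl x y z : brC (x + y) z = brC x z + brC y z.
Proof.
have reD : re_mx (x + y) = re_mx x + re_mx y.
  by apply/matrixP => i j; rewrite !mxE; case: (x i j) => ? ?; case: (y i j).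
have imD : im_mx (x + y) = im_mx x + im_mx y.
  by apply/matrixP => i j; rewrite !mxE; case: (x i j) => ? ?; case: (y i j).
rewrite /complex_bracket reD imD !lie_bracketDl cplx_mxD.
by congr cplx_mx; [rewrite opprD addrACA | rewrite addrACA].
Qed.

Lemma complex_bracketC x y : brC x y = - brC y x.
Proof.
rewrite /complex_bracket cplx_mxN.
by congr cplx_mx; rewrite (lie_bracketC c_atlas c_one (re_mx x))
  (lie_bracketC c_atlas c_one (im_mx x)); rewrite !opprD ?opprK // addrC.
Qed.

Lemma complex_bracket_conj x y :
  brC (map_mx (@conjc R) x) (map_mx (@conjc R) y) = map_mx (@conjc R) (brC x y).
Proof.
have reJ z : re_mx (map_mx (@conjc R) z) = re_mx z :> E.
  by apply/matrixP => i j; rewrite !mxE; case: (z i j).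
have imJ z : im_mx (map_mx (@conjc R) z) = - im_mx z :> E.
  by apply/matrixP => i j; rewrite !mxE; case: (z i j).
have brNl u v : br (- u) v = - br u v.
  by rewrite -scaleN1r lie_bracketZl scaleN1r.
have brNr u v : br u (- v) = - br u v.
  by rewrite -scaleN1r lie_bracketZr scaleN1r.
rewrite /complex_bracket !reJ !imJ !brNl !brNr opprK -opprD.
by apply/matrixP => i j; rewrite !mxE.
Qed.

Definition lower_centralC i : 'M[C]_m :=
  <<toC (vspace_mx (lower_central c i))>>%MS.

Lemma rank_lower_centralC i :
  \rank (lower_centralC i) = \dim (lower_central c i).
Proof. by rewrite mxrank_gen mxrank_map rank_vspace_mx. Qed.

Lemma sub_lower_centralC i w :
  (toC w <= lower_centralC i)%MS = (w \in lower_central c i).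
Proof. by rewrite genmxE map_submx mem_vspace_mx. Qed.

Lemma lower_centralC_re_im i x : (x <= lower_centralC i)%MS ->
  re_mx x \in lower_central c i /\ im_mx x \in lower_central c i.
Proof.
rewrite genmxE => /submxP[a ->].
rewrite -[a]cplx_re_im -cplx_mx_real cplx_mulmx re_cplx im_cplx !mulmx0.
by rewrite subr0 add0r -!mem_vspace_mx !submxMl.
Qed.

Lemma lower_centralC_conj i :
  (map_mx (@conjc R) (lower_centralC i) :=: lower_centralC i)%MS.
Proof.
rewrite /lower_centralC; apply: eqmx_trans (map_genmx _ _) _.
by rewrite -map_mx_comp (eq_map_mx _ (@conjc_real R)).
Qed.

Lemma lower_centralC_bracket i x y : (x <= lower_centralC i)%MS ->
  (brC x y <= lower_centralC i.+1)%MS.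
Proof.
move=> /lower_centralC_re_im[xr xi]; rewrite /complex_bracket cplx_mxE.
apply: addmx_sub; last apply: scalemx_sub; rewrite sub_lower_centralC.
  by apply: rpredB; exact: lower_central_bracket.
by apply: rpredD; exact: lower_central_bracket.
Qed.

Lemma lower_centralC_span i (W : 'M[C]_m) :
  (forall x y, (x <= lower_centralC i)%MS -> (brC x y <= W)%MS) ->
  (lower_centralC i.+1 <= W)%MS.
Proof.
move=> h; rewrite genmxE; apply/row_subP => k; rewrite -map_row rowK.
set w := _`_k; have : w \in lower_central c i.+1.
  by rewrite vbasis_mem // mem_nth // size_tuple.
rewrite /= -[[seq _ | u <- _, v <- _]]/(tval (in_tuple _)).
move=> /coord_span ->; rewrite raddf_sum; apply: summx_sub => l _.
rewrite /= map_mxZ; apply: scalemx_sub.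
have /allpairsP[[u v] /= [ub _ ->]] := mem_nth 0 (ltn_ord l : (l < size _)%N).
have -> : toC (br u v) = brC (toC u) (toC v).
  have reC (z : E) : re_mx (toC z) = z by apply/matrixP => a b; rewrite !mxE.
  have imC (z : E) : im_mx (toC z) = 0 by apply/matrixP => a b; rewrite !mxE.
  have br0r z : br z 0 = 0.
    by rewrite (lie_bracketC c_atlas c_one) lie_bracket0l oppr0.
  rewrite /complex_bracket !reC !imC !lie_bracket0l br0r subr0 addr0.
  by rewrite cplx_mx_real.
by apply: h; rewrite sub_lower_centralC vbasis_mem.
Qed.

End LowerCentralSeries.

(** * The obstruction *)

Section Obstruction.
Import Order.TTheory GRing.Theory Num.Theory.
Import numFieldTopology.Exports numFieldNormedType.Exports.
Local Open Scope classical_set_scope.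
Local Open Scope ring_scope.
Local Open Scope complex_scope.
Context {R : realType} {m : nat}.
Local Notation toC := (map_mx (real_complex R)).

Lemma local_diffeo_jac_unit (M N : manifold R m) (f : M -> N) c c' x :
  local_diffeo f -> atlas c -> atlas c' -> dom c x -> dom c' (f x) ->
  jac f c c' x \in unitmx.
Proof.
move=> fld ac ac' dx dfx.
have [U [V [g [[Uo Ux Vo] fU gV sf sg]]]] := fld x.
have [Vfx gfx] := fU x Ux.
have ok := atlas_ok ac; have ok' := atlas_ok ac'.
pose f1 := cmap c' \o f \o cinv c; pose g1 := cmap c \o g \o cinv c'.
have f1x : f1 (cmap c x) = cmap c' (f x) by rewrite /f1 /= (cmapK ok).
have df : differentiable f1 (cmap c x).
  by apply: (sf.2 c c' ac ac' 1).1; exists x.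
have dg : differentiable g1 (f1 (cmap c x)).
  rewrite f1x; apply: (sg.2 c' c ac' ac 1).1; exists (f x) => //.
  by split => //=; rewrite gfx.
have cc : {for cmap c x, continuous (cinv c)}.
  by apply: (continuous_cinv ok); exists x.
have near_gf : \forall q \near cmap c x, g1 (f1 q) = q.
  have near_cod : \forall q \near cmap c x, cod c q.
    by apply: open_nbhs_nbhs; split; [exact: (open_cod ok) | exists x].
  have nearU : \forall q \near cmap c x, U (cinv c q).
    by apply: cc; apply: open_nbhs_nbhs; rewrite (cmapK ok).
  have near_dom : \forall q \near cmap c x, dom c' (f (cinv c q)).
    have cf : {for cmap c x, continuous (f \o cinv c)}.
      by apply: continuous_comp cc _; rewrite (cmapK ok) //; exact: sf.1.
    apply: cf; apply: open_nbhs_nbhs; split; first exact: (open_dom ok').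
    by rewrite /= (cmapK ok).
  near=> q.
  have cq : cod c q by near: q.
  have Uq : U (cinv c q) by near: q.
  have dq : dom c' (f (cinv c q)) by near: q.
  rewrite /g1 /f1 /= (cmapK ok' dq) (fU _ Uq).2.
  by case: cq => y dy <-; rewrite (cmapK ok).
have gf1 : jac f c c' x *m jacobian g1 (f1 (cmap c x)) = 1%:M.
  apply/row_matrixP => i; rewrite !rowE mulmx1 mulmxA.
  rewrite /jac /jacobian !mul_rV_lin1.
  exact: (diff_left_inverse _ df dg near_gf).
exact: (mulmx1_unit gf1).1.
Unshelve. all: by end_near. Qed.

Section Quotient.
Context (M : manifold R m) (G : lieGroup R m) (pi : G -> M) (c : chart R m G).
Hypotheses (c_atlas : atlas c) (c_one : dom c (gone G)).
Hypothesis (pi_local_diffeo : local_diffeo pi).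
Context (J : endo_field M) (JG : endo_field G) (k : nat).
Hypotheses (piJ : intertwines pi JG J) (Jk : has_type J k).

(** The forms annihilated by the eigenspace on the quotient have degree at
    least the type, which bounds the rank there; the differential of the
    covering map, being invertible, carries the bound back to the group. *)
Lemma rank_holomorphic_part : (\rank (holomorphic_part c JG) + k <= m)%N.
Proof.
have [c' ac' dc'] := atlas_cover (pi (gone G)).
have inter := piJ c_atlas ac' c_one dc'.
have unitP := local_diffeo_jac_unit pi_local_diffeo c_atlas ac' c_one dc'.
set P := jac _ _ _ _ in unitP.
have cp : cod c' (cmap c' (pi (gone G))) by exists (pi (gone G)).
have [B [w [theta [_ _ [nz annih]]]]] := Jk ac' cp.
set rho := wedge _ _ in nz annih.
have -> : \rank (holomorphic_part c JG) =
    \rank (holomorphic_part c JG *m toC P).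
  by rewrite mxrankMfree // row_free_map row_free_unit.
apply: (rank_annihilator_spinor nz).
  by apply: (@degree_ge_wedge _ _ 0) => //; exact: degree_ge_wedge_all.
move=> _ /submxP[a ->].
have [|u uL ux] := @lsubmx_submxP _ _ _ (eigL (JG c (cmap c (gone G))))
    (a *m holomorphic_part c JG).
  exact: submxMl.
exists (rsubmx (u *m toC (gjac pi c c' (gone G)))).
rewrite mulmxA -ux.
have -> : lsubmx u *m toC P = lsubmx (u *m toC (gjac pi c c' (gone G))).
  rewrite /gjac -/P map_block_mx -[u in RHS]hsubmxK mul_row_block row_mxKl.
  by rewrite map_mx0 mulmx0 addr0.
rewrite hsubmxK.
have /annih : exists a, rho = a *: rho by exists 1; rewrite scale1r.
by apply; exact: eigL_intertwine inter uL.
Qed.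

End Quotient.

Lemma unit_steps (d : nat -> nat) (s j : nat) : (j <= s)%N -> d s = 0%N ->
  (forall i, (j <= i < s)%N -> d i = (d i.+1).+1) -> d j = (s - j)%N.
Proof.
move=> js ds step; suff h i : (i + j <= s)%N -> d (s - i)%N = i.
  by rewrite -[in LHS](subKn js) h // subnK.
elim: i => [|i IH] lei; first by rewrite subn0.
rewrite step; last by lia.
rewrite (_ : (s - i.+1).+1 = s - i)%N; last by lia.
by rewrite IH //; lia.
Qed.

(** The holomorphic part has rank at most [m - k <= s - j], the dimension of
    g^j, while [rank_subalgebra_gt] makes it strictly larger. The case [m = 0]
    is separate, since then nilpotency index and type are both 0. *)
Lemma no_left_invariant_gcs (M : manifold R m) (G : lieGroup R m) (pi : G -> M)
    (c : chart R m G) (s j k : nat) :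
  local_diffeo pi -> atlas c -> dom c (gone G) -> nilpotency_index c s ->
  (0 < j)%N ->
  (forall i, (j <= i < s)%N ->
     \dim (lower_central c i) = (\dim (lower_central c i.+1)).+1) ->
  (m + j <= k + s)%N -> ~ admits_left_invariant_gcs pi k.
Proof.
move=> pi_ld ac dc [lcs lct] j_gt0 dl le_mj [J [JG [_ [gcJ invJ] inter Jk]]].
have rkE := rank_holomorphic_part ac dc pi_ld inter Jk.
have [m0|m_gt0] := posnP m.
  have s0 : s = 0%N.
    case: (posnP s) => // /lct /eqP; rewrite -dimv_eq0 /= dim_fullv_row.
    by rewrite m0 eqxx.
  by move: rkE le_mj; rewrite s0; lia.
have js : (0 < j <= s)%N by move: rkE; lia.
have dlj : \dim (lower_central c j) = (s - j)%N.
  apply: (unit_steps (d := fun i => \dim (lower_central c i))) => //.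
    by case/andP: js.
  by rewrite lcs dimv0.
suff : (\dim (lower_central c j) < \rank (holomorphic_part c JG))%N.
  by move: rkE; rewrite dlj; lia.
rewrite -rank_lower_centralC -[X in (_ < X)%N]mxrank_gen.
apply: (@rank_subalgebra_gt _ (@conjc R) m (complex_bracket c)
  (lower_centralC c) _ (@conjcK R) _ _ _ _ _ _ _ _ _ s) => //.
- exact: complex_bracketDl.
- exact: complex_bracketC.
- exact: complex_bracket_conj.
- by apply/eqP; rewrite rank_lower_centralC /= dim_fullv_row.
- exact: lower_centralC_bracket.
- exact: lower_centralC_span.
- exact: lower_centralC_conj.
- by move=> x y; rewrite !genmxE; exact: holomorphic_part_subalgebra.
- have full := eigL_conj_full (gc_square gcJ ac (cod_cmap dc)).
  rewrite -sub1mx (submx_trans (submx_full _ full)) //.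
  by rewrite addsmxS ?map_submx ?genmxE.
- by rewrite rank_lower_centralC lcs dimv0.
- by move=> i ji; rewrite !rank_lower_centralC dl.
Qed.

End Obstruction.

Theorem theorem3p3 (R : realType) (n : nat)
    (M : manifold R (2 * n)) (G : lieGroup R (2 * n)) (Gamma : set G)
    (pi : G -> M) (c : chart R (2 * n) G) (s : nat) :
  is_nilmanifold Gamma pi ->
  atlas c -> dom c (gone G) ->
  nilpotency_index c s ->
  (forall j : nat, (0 < j)%N ->
     (forall i : nat, (j <= i < s)%N ->
        (\dim (Vspace c i.+1) - \dim (Vspace c i))%N = 1%N) ->
     forall k : nat, (2 * n + j <= k + s)%N ->
       ~ admits_left_invariant_gcs pi k)
  /\
  (\dim (Vspace c 1) = 2%N ->
   (forall i : nat, (1 < i <= s)%N ->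
      (\dim (Vspace c i) - \dim (Vspace c i.-1))%N = 1%N) ->
   forall k : nat, (2 <= k)%N -> ~ admits_left_invariant_gcs pi k).
Proof.
move=> nilM ac dc nil.
have pi_ld := nilm_local_diffeo nilM.
have dimV i : (\dim (Vspace c i) + \dim (lower_central c i))%N = (2 * n)%N.
  exact: dim_annihilator.
split=> [j j_gt0 dV k|dV1 dV k k2].
  apply: (no_left_invariant_gcs pi_ld ac dc nil j_gt0) => i ji.
  by have := dV i ji; have := dimV i; have := dimV i.+1; lia.
have [lcs lct] := nil.
have ds : \dim (lower_central c s) = 0%N by rewrite lcs dimv0.
have s_gt0 : (0 < s)%N.
  case: (posnP s) ds => // -> d0; move: (dimV 1%N); rewrite dV1.
  have := dim_fullv_row : \dim (lower_central c 0) = (2 * n)%N.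
  by rewrite d0; lia.
have step i : (1 <= i < s)%N ->
    \dim (lower_central c i) = (\dim (lower_central c i.+1)).+1.
  move=> /andP[i1 lt_is].
  by have := dV i.+1; have := dimV i; have := dimV i.+1; rewrite /=; lia.
have dl1 := @unit_steps (fun i => \dim (lower_central c i)) s 1 s_gt0 ds step.
apply: (no_left_invariant_gcs pi_ld ac dc nil _ step) => //.
by move: (dimV 1%N); rewrite dV1 dl1; lia.
Qed.
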